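(* Let $\mathcal V=\{V;\nu_1,\dots,\nu_n\}$ be a vector arrangement over $\Bbbk$ with associated hyperplane arrangement $\mathcal H$. Then $(\mathcal C,\partial,m)$ is a differential graded algebra, and hence $H_\partial^\bullet(\mathcal H)$ is a graded algebra.
   Context: Let $\Bbbk$ be a field of characteristic zero. A vector arrangement $\mathcal V=\{V;\nu_1,\dots,\nu_n\}$ is a finite-dimensional $\Bbbk$-vector space $V$ with an inner product together with a list of vectors $\nu_i\in V$ (zero allowed). The associated hyperplane arrangement is $\mathcal H=\{V;H_1,\dots,H_n\}$, $H_i=\nu_i^\perp$. For $S\subseteq[n]=\{1,\dots,n\}$ put $H_S=\bigcap_{s\in S}H_s$ ($H_\emptyset=V$) and $C_S=\bigwedge^\bullet H_S$. The inner product is understood to restrict non-degenerately to all subspaces onto which orthogonal projections are taken. $\mathcal C=\bigoplus_{S\subseteq[n]}C_S$ with bigrading $\deg\bigwedge^iH_S=(|S|+i,\,i)$. For $s\in S$, $\partial_{S,s}:\bigwedge^\bullet H_S\to\bigwedge^{\bullet+1}H_{S-s}$ is the inclusion $\bigwedge^\bullet H_S\subseteq\bigwedge^\bullet H_{S-s}$ followed by wedging on the left with the orthogonal projection of $\nu_s$ to $H_{S-s}$. The differential is $\partial=\bigoplus_{S,\,s\in S}\partial_{S,s}$, of bidegree $(0,1)$; the second degree is homological. $H_\partial^\bullet(\mathcal H)$ is the homology of $(\mathcal C,\partial)$. Multiplication $m:C_S\otimes C_T\to C_{S\cup T}$: $m=0$ if $S\cap T\neq\emptyset$; if $S\cap T=\emptyset$,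 $m(h\otimes h')=h\wedge h'$, the wedge being taken in $\bigwedge^\bullet H_{S\cup T}$ after applying the maps induced by orthogonal projections $H_S\to H_{S\cup T}$, $H_T\to H_{S\cup T}$ to $h$ and $h'$. Compatibility with the differential means $\partial(m(h\otimes h'))=m(\partial h\otimes h')+(-1)^jm(h\otimes\partial h')$ for $h$ of second (exterior) degree $j$. *)

(* Defs.v *)
From HB Require Import structures.
From mathcomp Require Import all_boot all_order all_algebra.

Set Implicit Arguments.
Unset Strict Implicit.
Unset Printing Implicit Defensive.

Import GRing.Theory.
Local Open Scope ring_scope.

Section Inversions.
Variable d : nat.
Implicit Types I J L : {set 'I_d}.

Definition inversions I J : nat := (\sum_(i in I) \sum_(j in J) (j < i))%N.

Lemma disjointUl I J L :
  [disjoint I :|: J & L] = [disjoint I & L] && [disjoint J & L].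
Proof. by rewrite -!setI_eq0 setIUl setU_eq0. Qed.

Lemma inversionsUl I J L : [disjoint I & J] ->
  inversions (I :|: J) L = (inversions I L + inversions J L)%N.
Proof.
move=> dIJ; rewrite /inversions -bigU //=.
by apply: eq_bigl => i; rewrite inE.
Qed.

Lemma inversionsUr I J L : [disjoint J & L] ->
  inversions I (J :|: L) = (inversions I J + inversions I L)%N.
Proof.
move=> dJL; rewrite /inversions -big_split /=.
apply: eq_bigr => i _; rewrite -bigU //=.
by apply: eq_bigl => j; rewrite inE.
Qed.

End Inversions.

Section ExteriorAlgebra.
Variables (K : fieldType) (V : vectType K).
Local Notation d := (\dim {:V}).
Implicit Types I J L : {set 'I_d}.

(* The exterior algebra of V: the coordinate at I is that of the wedge, in    *)
(* increasing order of i \in I, of the i-th vectors of the basis vbasis {:V}. *)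
(* It is characterised up to isomorphism by ext_universal below.              *)
Definition ext : Type := {ffun {set 'I_d} -> K^o}.

HB.instance Definition _ := Vector.copy ext {ffun {set 'I_d} -> K^o}.

Definition ext_basis I : ext := [ffun J => (J == I)%:R].

Definition ext_mul (x y : ext) : ext :=
  \sum_(I : {set 'I_d}) \sum_(J : {set 'I_d} | [disjoint I & J])
    ((-1) ^+ inversions I J * (x I * y J)) *: ext_basis (I :|: J).

Definition ext_one : ext := ext_basis set0.

Let ext_linE (k : K) (x y : ext) I : (k *: x + y) I = k * x I + y I.
Proof. by rewrite !ffunE. Qed.

Let ext_mulr y x := ext_mul x y.

Let ext_mul_linl (y : ext) : linear (ext_mulr y).
Proof.
move=> k x x'; rewrite /ext_mulr /ext_mul scaler_sumr -big_split /=.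
apply: eq_bigr => I _; rewrite scaler_sumr -big_split /=.
apply: eq_bigr => J _; rewrite ext_linE scalerA -scalerDl; congr (_ *: _).
by rewrite mulrDl mulrDr -!mulrA (mulrCA _ k).
Qed.

Let ext_mul_linr (x : ext) : linear (ext_mul x).
Proof.
move=> k y y'; rewrite /ext_mul scaler_sumr -big_split /=.
apply: eq_bigr => I _; rewrite scaler_sumr -big_split /=.
apply: eq_bigr => J _; rewrite ext_linE scalerA -scalerDl; congr (_ *: _).
by rewrite mulrDr mulrDr (mulrCA _ k) (mulrCA _ k).
Qed.

Let ext_mulPl k u v w : ext_mul (k *: u + v) w = k *: ext_mul u w + ext_mul v w.
Proof. exact: ext_mul_linl. Qed.

Let ext_mulPr k u v w : ext_mul w (k *: u + v) = k *: ext_mul w u + ext_mul w v.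
Proof. exact: ext_mul_linr. Qed.

Let ext_mul0l w : ext_mul 0 w = 0.
Proof.
by have /eqP := ext_mulPl 1 0 0 w; rewrite !scale1r addr0 -subr_eq0 opprD addNKr
  oppr_eq0 => /eqP.
Qed.

Let ext_mul0r w : ext_mul w 0 = 0.
Proof.
by have /eqP := ext_mulPr 1 0 0 w; rewrite !scale1r addr0 -subr_eq0 opprD addNKr
  oppr_eq0 => /eqP.
Qed.

Let ext_mulZl k u w : ext_mul (k *: u) w = k *: ext_mul u w.
Proof. by rewrite -[k *: u]addr0 ext_mulPl ext_mul0l addr0. Qed.

Let ext_mulZr k u w : ext_mul w (k *: u) = k *: ext_mul w u.
Proof. by rewrite -[k *: u]addr0 ext_mulPr ext_mul0r addr0. Qed.

Lemma ext_sum_basis (x : ext) : x = \sum_I x I *: ext_basis I.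
Proof.
apply/ffunP=> J; rewrite sum_ffunE (bigD1 J) //= !ffunE eqxx.
rewrite [_ *: _]mulr1 big1 ?addr0 // => I nIJ.
by rewrite !ffunE eq_sym (negPf nIJ) scaler0.
Qed.

Let ext_mul_basis I J :
  ext_mul (ext_basis I) (ext_basis J) =
  if [disjoint I & J] then (-1) ^+ inversions I J *: ext_basis (I :|: J) else 0.
Proof.
rewrite /ext_mul (bigD1 I) //= [X in _ + X]big1 ?addr0; last first.
  move=> I' nI'; apply: big1 => J' _.
  by rewrite !ffunE (negPf nI') mul0r mulr0 scale0r.
rewrite big_mkcond (bigD1 J) //= [X in _ + X]big1 ?addr0; last first.
  move=> J' nJ'; case: ifP => // _.
  by rewrite !ffunE (negPf nJ') !mulr0 scale0r.
by rewrite !ffunE !eqxx !mulr1.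
Qed.

Let ext_eq_lin (f g : ext -> ext) : linear f -> linear g ->
  (forall I, f (ext_basis I) = g (ext_basis I)) -> f =1 g.
Proof.
move=> lf lg fg w.
pose f' : {linear ext -> ext} :=
  HB.pack f (GRing.isLinear.Build K ext ext _ f lf).
pose g' : {linear ext -> ext} :=
  HB.pack g (GRing.isLinear.Build K ext ext _ g lg).
rewrite -[f]/(f' : _ -> _) -[g]/(g' : _ -> _) (ext_sum_basis w) !linear_sum.
by apply: eq_bigr => I _; rewrite !linearZ /= fg.
Qed.

Fact ext_mulA : associative ext_mul.
Proof.
move=> x y z.
apply: (@ext_eq_lin (fun z => ext_mul x (ext_mul y z))
  (fun z => ext_mul (ext_mul x y) z)) => [k u v|k u v|L].
- by rewrite !ext_mulPr.
- by rewrite ext_mulPr.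
apply: (@ext_eq_lin (fun y => ext_mul x (ext_mul y (ext_basis L)))
  (fun y => ext_mul (ext_mul x y) (ext_basis L))) => [k u v|k u v|J].
- by rewrite ext_mulPl ext_mulPr.
- by rewrite ext_mulPr ext_mulPl.
apply: (@ext_eq_lin (fun x => ext_mul x (ext_mul (ext_basis J) (ext_basis L)))
  (fun x => ext_mul (ext_mul x (ext_basis J)) (ext_basis L)))
  => [k u v|k u v|I].
- by rewrite ext_mulPl.
- by rewrite !ext_mulPl.
rewrite !ext_mul_basis.
have [dJL|/negPf nJL] := boolP [disjoint J & L]; last first.
  rewrite ext_mul0r; case: ifP => [dIJ|_]; last first.
    by rewrite ext_mul0l.
  rewrite ext_mulZl ext_mul_basis.
  by rewrite disjointUl nJL andbF scaler0.
rewrite ext_mulZr ext_mul_basis disjoint_sym disjointUl.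
have [dIJ|/negPf nIJ] := boolP [disjoint I & J]; last first.
  rewrite (disjoint_sym J) nIJ /= scaler0.
  by rewrite ext_mul0l.
rewrite ext_mulZl ext_mul_basis disjointUl dJL andbT.
rewrite (disjoint_sym J) dIJ /= disjoint_sym.
case: ifP => [dIL|]; last by rewrite !scaler0.
rewrite !scalerA -!exprD setUA inversionsUl // inversionsUr //.
by congr (_ ^+ _ *: _); rewrite addnC addnA.
Qed.

Let ext_mul1r : left_id ext_one ext_mul.
Proof.
apply: (ext_eq_lin (g := id)) => [||I]; first exact: ext_mul_linr.
- by move=> k u v.
- rewrite ext_mul_basis.
  by rewrite -setI_eq0 set0I eqxx set0U /inversions big_set0 scale1r.
Qed.

Let ext_mulr1 : right_id ext_one ext_mul.
Proof.
apply: (ext_eq_lin (g := id)) => [||I]; first exact: ext_mul_linl.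
- by move=> k u v.
- rewrite ext_mul_basis -setI_eq0 setI0 eqxx setU0 /inversions.
  by rewrite big1 ?scale1r // => i _; rewrite big_set0.
Qed.

Let ext_mulDl : left_distributive ext_mul +%R.
Proof. by move=> x y z; rewrite -[x]scale1r ext_mulPl !scale1r. Qed.

Let ext_mulDr : right_distributive ext_mul +%R.
Proof. by move=> x y z; rewrite -[y]scale1r ext_mulPr !scale1r. Qed.

Let ext_oner_neq0 : ext_one != 0.
Proof.
by apply/eqP=> /ffunP/(_ set0)/eqP; rewrite !ffunE eqxx oner_eq0.
Qed.

HB.instance Definition _ := GRing.Zmodule_isNzRing.Build ext
  ext_mulA ext_mul1r ext_mulr1 ext_mulDl ext_mulDr ext_oner_neq0.

Let ext_scalerAl (k : K) (x y : ext) : k *: (x * y) = (k *: x) * y.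
Proof. by rewrite -[RHS]/(ext_mul _ _) ext_mulZl. Qed.

Let ext_scalerAr (k : K) (x y : ext) : k *: (x * y) = x * (k *: y).
Proof. by rewrite -[RHS]/(ext_mul _ _) ext_mulZr. Qed.

HB.instance Definition _ := GRing.Lmodule_isLalgebra.Build K ext ext_scalerAl.
HB.instance Definition _ := GRing.Lalgebra_isAlgebra.Build K ext ext_scalerAr.


Lemma ext_basisM I J :
  ext_basis I * ext_basis J =
  if [disjoint I & J] then (-1) ^+ inversions I J *: ext_basis (I :|: J) else 0.
Proof. exact: ext_mul_basis. Qed.

Definition ext_inj (v : V) : ext :=
  \sum_i coord (vbasis {:V}) i v *: ext_basis [set i].

Fact ext_inj_is_linear : linear ext_inj.
Proof.
move=> k u v; rewrite /ext_inj scaler_sumr -big_split /=.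
by apply: eq_bigr => i _; rewrite linearP scalerDl scalerA.
Qed.

HB.instance Definition _ :=
  GRing.isLinear.Build K V ext _ ext_inj ext_inj_is_linear.

Definition ext_homog (q : nat) (x : ext) : Prop :=
  forall I, x I != 0 -> #|I| = q.

(* enum I lists the ordinals of I in increasing order.                        *)
Definition ext_lift (A : algType K) (g : V -> A) (x : ext) : A :=
  \sum_I x I *: \prod_(i <- enum I) g (vbasis {:V})`_i.

Fact ext_lift_is_linear (A : algType K) (g : V -> A) : linear (ext_lift g).
Proof.
move=> k x y; rewrite /ext_lift scaler_sumr -big_split /=.
by apply: eq_bigr => I _; rewrite ext_linE scalerDl scalerA.
Qed.

HB.instance Definition _ (A : algType K) (g : V -> A) :=
  GRing.isLinear.Build K ext A _ (ext_lift g) (ext_lift_is_linear g).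

End ExteriorAlgebra.

Section AlternatingProducts.
Variables (K : fieldType) (A : algType K) (d : nat) (G : 'I_d -> A).
Hypothesis G2 : forall i, G i * G i = 0.
Hypothesis GC : forall i j, G i * G j = - (G j * G i).
Implicit Types I J : {set 'I_d}.
Local Notation P I := (\prod_(i <- enum I) G i).

Let prodU1 (j : 'I_d) J :
  (forall k, k \in J -> (j < k)%N) -> P (j |: J) = G j * P J.
Proof.
move=> jJ; suff -> : enum (j |: J) = j :: enum J by rewrite big_cons.
have ltT : transitive (fun i k : 'I_d => (i < k)%N).
  by move=> ? ? ?; apply: ltn_trans.
have ltI : irreflexive (fun i k : 'I_d => (i < k)%N) by move=> ?; apply: ltnn.
have enumS (B : {set 'I_d}) :
    sorted (fun i k : 'I_d => (i < k)%N) (enum B).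
  rewrite /enum_mem; apply: sorted_filter => //.
  rewrite -enumT -(@sorted_map _ _ val ltn) val_enum_ord.
  exact: iota_ltn_sorted.
apply: (irr_sorted_eq ltT ltI) => //.
  rewrite /= (path_sortedE ltT) enumS andbT.
  by apply/allP=> k; rewrite mem_enum => /jJ.
by move=> k; rewrite inE !mem_enum !inE.
Qed.

Lemma mul_gen_prod i J :
  G i * P J = if i \in J then 0
              else (-1) ^+ inversions [set i] J *: P (i |: J).
Proof.
have inv1 B : inversions [set i] B = (\sum_(k in B) (k < i))%N.
  by rewrite /inversions big_set1.
have [m] := ubnP #|J|; elim: m J => // m IH J leJ.
have [->|[j0 j0J]] := set_0Vmem J.
  by rewrite inE inv1 big_set0 prodU1 ?scale1r // => k; rewrite inE.
have [j jJ' jmin] := arg_minnP val j0J; have jJ : j \in J by [].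
have ltj k : k \in J :\ j -> (j < k)%N.
  by rewrite !inE eq_sym ltn_neqAle (inj_eq val_inj) => /andP[-> /jmin].
have PJ : P J = G j * P (J :\ j) by rewrite -prodU1 ?setD1K.
have [ij|ji|eij] := ltngtP i j; last first.
- by rewrite (val_inj eij : i = j) jJ PJ mulrA G2 mul0r.
- rewrite PJ mulrA GC mulNr -mulrA IH; last first.
    by move: leJ; rewrite (cardsD1 j) jJ.
  have nij : i != j by apply: contraTneq ji => ->; rewrite ltnn.
  rewrite !inE nij /=; case: ifP => [_|iJ]; first by rewrite mulr0 oppr0.
  rewrite -scalerAr -prodU1 => [|k]; last first.
    by rewrite !inE -in_setD1 => /orP[/eqP->|/ltj].
  rewrite setUCA setD1K // !inv1 (big_setD1 j jJ) /= ji exprS mulN1r scaleNr.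
  by [].
- have ltJ k : k \in J -> (i < k)%N by move=> /jmin; apply: (leq_trans ij).
  case: ifP => [/ltJ|_]; first by rewrite ltnn.
  rewrite prodU1 // inv1 [X in _ ^+ X]big1 ?scale1r // => k /ltJ ik.
  by rewrite ltnNge ltnW.
Qed.

Lemma prod_alternating I J :
  P I * P J = if [disjoint I & J] then (-1) ^+ inversions I J *: P (I :|: J)
              else 0.
Proof.
have [m] := ubnP #|I|; elim: m I => // m IH I leI.
have [->|[j0 j0I]] := set_0Vmem I.
  by rewrite enum_set0 big_nil mul1r -setI_eq0 set0I eqxx set0U /inversions
     big_set0 scale1r.
have [j jI' jmin] := arg_minnP val j0I; have jI : j \in I by [].
have ltj k : k \in I :\ j -> (j < k)%N.
  by rewrite !inE eq_sym ltn_neqAle (inj_eq val_inj) => /andP[-> /jmin].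
have dj : [disjoint [set j] & I :\ j] by rewrite disjoints1 !inE eqxx.
have -> : P I = G j * P (I :\ j) by rewrite -prodU1 ?setD1K.
rewrite -mulrA IH; last by move: leI; rewrite (cardsD1 j) jI.
have dIE : [disjoint I & J] = (j \notin J) && [disjoint I :\ j & J].
  by rewrite -{1}(setD1K jI) disjointUl disjoints1.
rewrite dIE andbC; have [dIJ|_] := ifP; last by rewrite mulr0.
rewrite -scalerAr mul_gen_prod !inE eqxx /=.
have [jJ|jJ] := ifP; first by rewrite scaler0.
have -> : inversions I J = (inversions [set j] J + inversions (I :\ j) J)%N.
  by rewrite -inversionsUl // setD1K.
rewrite scalerA -exprD setUA setD1K // inversionsUr // addnA.
rewrite [X in (_ + X + _)%N](_ : _ = 0%N) ?addn0 1?addnC //.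
rewrite /inversions big_set1 big1 // => k /ltj jk.
by rewrite ltnNge ltnW.
Qed.

End AlternatingProducts.

Section UniversalProperty.
Variables (K : fieldType) (V : vectType K).
Local Notation d := (\dim {:V}).
Local Notation b := (vbasis {:V}).
Implicit Types I J : {set 'I_d}.

Let e (i : 'I_d) : ext V := ext_basis [set i].

Let ee i : e i * e i = 0.
Proof. by rewrite ext_basisM disjoints1 inE eqxx. Qed.

Let eC i j : e i * e j = - (e j * e i).
Proof.
have [->|nij] := eqVneq i j; first by rewrite ee oppr0.
rewrite !ext_basisM !disjoints1 !inE (eq_sym j i) nij setUC -scaleNr.
congr (_ *: _); rewrite /inversions !big_set1.
case: (ltngtP i j) => [_|_|/val_inj eij]; rewrite ?expr0 ?expr1 ?opprK //.
by rewrite eij eqxx in nij.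
Qed.

Lemma ext_basis_prod I : ext_basis I = \prod_(i <- enum I) e i.
Proof.
have [m] := ubnP #|I|; elim: m I => // m IH I leI.
have [->|[i iI]] := set_0Vmem I; first by rewrite enum_set0 big_nil.
have := mul_gen_prod ee eC i (I :\ i).
rewrite -(IH (I :\ i)); last by move: leI; rewrite (cardsD1 i) iI.
rewrite ext_basisM disjoints1 !inE eqxx setD1K //=.
by apply: scalerI; rewrite expf_neq0 ?oppr_eq0 ?oner_neq0.
Qed.

Lemma ext_inj_basis (i : 'I_d) : ext_inj b`_i = e i.
Proof.
rewrite /ext_inj (bigD1 i) //= coord_free ?(basis_free (vbasisP _)) //.
rewrite eqxx scale1r big1 ?addr0 // => j nji.
by rewrite coord_free ?(basis_free (vbasisP _)) // eq_sym (negPf nji) scale0r.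
Qed.

Lemma ext_inj_sqr (v : V) : ext_inj v * ext_inj v = 0.
Proof.
pose c i : K := coord b i v; rewrite /ext_inj mulr_suml.
pose F i j := (c i *: e i) * (c j *: e j).
have FC i j : F i j = - F j i.
  by rewrite /F -!scalerAl -!scalerAr eC !scalerN !scalerA mulrC.
have F0 i : F i i = 0 by rewrite /F -!scalerAl -!scalerAr ee !scaler0.
transitivity (\sum_(i < d) \sum_(j < d) ((if (j < i)%N then F i j else 0)
                             + (if (i < j)%N then F i j else 0))).
  apply: eq_bigr => i _; rewrite mulr_sumr; apply: eq_bigr => j _.
  rewrite -/(F i j); case: ltngtP => [||/val_inj->]; rewrite ?addr0 ?add0r //.
under eq_bigr do rewrite big_split.
rewrite big_split /= [X in _ + X]exchange_big -big_split big1 //= => i _.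
rewrite -big_split big1 //= => j _.
by case: ifP; rewrite ?addr0 // FC addNr.
Qed.

Theorem ext_universal (A : algType K) (g : {linear V -> A}) :
  (forall v, g v * g v = 0) ->
  [/\ forall v, ext_lift g (ext_inj v) = g v,
      ext_lift g 1 = 1,
      {morph ext_lift g : x y / x * y}
    & forall f : {linear ext V -> A},
        f 1 = 1 -> {morph f : x y / x * y} ->
        (forall v, f (ext_inj v) = g v) -> f =1 ext_lift g].
Proof.
move=> g2; pose G i := g b`_i.
have G2 i : G i * G i = 0 by exact: g2.
have GC i j : G i * G j = - (G j * G i).
  have := g2 (b`_i + b`_j); rewrite linearD mulrDl !mulrDr !g2 add0r addr0.
  by move/eqP; rewrite addr_eq0 => /eqP.
have liftE I : ext_lift g (ext_basis I) = \prod_(i <- enum I) G i.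
  rewrite /ext_lift (bigD1 I) //= ffunE eqxx scale1r.
  rewrite [X in _ + X]big1 ?addr0 // => J nJI.
  by rewrite ffunE (negPf nJI) scale0r.
split.
- move=> v; rewrite {2}(coord_vbasis (memvf v)) /ext_inj !linear_sum.
  apply: eq_bigr => i _; rewrite !linearZ /= liftE.
  by rewrite enum_set1 big_seq1.
- by rewrite -[1]/(ext_basis set0) liftE enum_set0 big_nil.
- move=> x y; rewrite (ext_sum_basis x) (ext_sum_basis y).
  rewrite mulr_suml !linear_sum mulr_suml; apply: eq_bigr => I _.
  rewrite mulr_sumr linear_sum mulr_sumr; apply: eq_bigr => J _.
  rewrite -scalerAl -scalerAr !linearZ /= -scalerAl -scalerAr.
  do 2 congr (_ *: _).
  rewrite !liftE prod_alternating // ext_basisM.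
  by case: ifP => _; rewrite ?linear0 // linearZ /= liftE.
- move=> f f1 fM fi x; rewrite (ext_sum_basis x) !linear_sum.
  apply: eq_bigr => I _; rewrite !linearZ /= liftE ext_basis_prod.
  congr (_ *: _).
  rewrite (big_morph f fM f1); apply: eq_bigr => i _.
  by rewrite -ext_inj_basis fi.
Qed.

End UniversalProperty.

Section DirectSum.
Variables (K : fieldType) (I : finType) (T : I -> vectType K).

Definition dirsum : Type := {dffun forall i, T i}.

HB.instance Definition _ := Choice.copy dirsum {dffun forall i, T i}.

Implicit Types c : dirsum.

Let add c c' : dirsum := [ffun i => c i + c' i].
Let opp c : dirsum := [ffun i => - c i].
Let zero : dirsum := [ffun i => 0].
Let scale k c : dirsum := [ffun i => k *: c i].

Let addA : associative add.
Proof. by move=> x y z; apply/ffunP=> i; rewrite !ffunE addrA. Qed.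
Let addC : commutative add.
Proof. by move=> x y; apply/ffunP=> i; rewrite !ffunE addrC. Qed.
Let add0 : left_id zero add.
Proof. by move=> x; apply/ffunP=> i; rewrite !ffunE add0r. Qed.
Let addN : left_inverse zero opp add.
Proof. by move=> x; apply/ffunP=> i; rewrite !ffunE addNr. Qed.

HB.instance Definition _ := GRing.isZmodule.Build dirsum addA addC add0 addN.

Let scaleA a b c : scale a (scale b c) = scale (a * b) c.
Proof. by apply/ffunP=> i; rewrite !ffunE scalerA. Qed.
Let scale1 : left_id 1 scale.
Proof. by move=> x; apply/ffunP=> i; rewrite !ffunE scale1r. Qed.
Let scaleDr : right_distributive scale +%R.
Proof. by move=> k x y; apply/ffunP=> i; rewrite !ffunE scalerDr. Qed.
Let scaleDl c : {morph scale^~ c : a b / a + b}.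
Proof. by move=> a b; apply/ffunP=> i; rewrite !ffunE scalerDl. Qed.

HB.instance Definition _ :=
  GRing.Zmodule_isLmodule.Build K dirsum scaleA scale1 scaleDr scaleDl.

Lemma dirsum_addE c c' i : (c + c') i = c i + c' i. Proof. exact: ffunE. Qed.
Lemma dirsum_oppE c i : (- c) i = - c i. Proof. exact: ffunE. Qed.
Lemma dirsum_0E i : (0 : dirsum) i = 0. Proof. exact: ffunE. Qed.
Lemma dirsum_scaleE k c i : (k *: c) i = k *: c i. Proof. exact: ffunE. Qed.

Let coords := {ffun {i : I & 'I_(dim (T i))} -> K^o}.

Import VectorInternalTheory.

Fact dirsum_vect_iso : Vector.axiom (dim coords) dirsum.
Proof.
pose f c : coords := [ffun u => v2r (c (tag u)) 0 (tagged u)].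
pose g (w : coords) : dirsum :=
  [ffun i => r2v (\row_j w (Tagged (fun i => 'I_(dim (T i))) j))].
have fl : linear f.
  move=> k c c'; apply/ffunP=> u.
  by rewrite !ffunE linearP !mxE.
exists (v2r \o f).
  by move=> k c c' /=; rewrite fl linearP.
exists (g \o r2v) => [c|w] /=.
  rewrite v2rK; apply/ffunP=> i; rewrite ffunE; apply: (canLR v2rK).
  by apply/rowP=> j; rewrite !mxE ffunE.
apply: (canLR r2vK); apply/ffunP=> -[i j]; rewrite !ffunE r2vK /= mxE.
by [].
Qed.

HB.instance Definition _ := Lmodule_hasFinDim.Build K dirsum dirsum_vect_iso.

Definition dirsum_inj (i : I) (x : T i) : dirsum :=
  [ffun j => dfwith (fun j => 0 : T j) x j].

Fact dirsum_inj_is_linear i : linear (@dirsum_inj i).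
Proof.
move=> k x y; apply/ffunP=> j.
rewrite dirsum_addE dirsum_scaleE !ffunE.
have [eij|nij] := eqVneq i j; last by rewrite !dfwith_out // scaler0 addr0.
by case: j / eij; rewrite !dfwith_in.
Qed.

HB.instance Definition _ i :=
  GRing.isLinear.Build K (T i) dirsum _ (@dirsum_inj i)
    (@dirsum_inj_is_linear i).

End DirectSum.

Section QuotientSpace.
Variables (K : fieldType) (V : vectType K) (U : {vspace V}).
Local Open Scope quotient_scope.

Definition quotv : Type := Quotient.quot (pred_of_vspace U).

HB.instance Definition _ := GRing.Zmodule.on quotv.

Definition quotv_pi (v : V) : quotv := \pi_(Quotient.quot (pred_of_vspace U)) v.

Let scale (k : K) (x : quotv) : quotv := quotv_pi (k *: repr x).

Lemma quotv_pi_eq (u v : V) : (quotv_pi u == quotv_pi v) = (u - v \in U).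
Proof. by rewrite -Quotient.idealrBE. Qed.

Let piK x : quotv_pi (repr x) = x. Proof. exact: reprK. Qed.

Let piD : {morph quotv_pi : u v / u + v}.
Proof. by move=> u v; rewrite /quotv_pi !piE. Qed.

Let scale_pi k v : scale k (quotv_pi v) = quotv_pi (k *: v).
Proof.
by apply/eqP; rewrite quotv_pi_eq -scalerBr memvZ // -quotv_pi_eq piK.
Qed.

Let scaleA a b x : scale a (scale b x) = scale (a * b) x.
Proof. by rewrite -[x]piK !scale_pi scalerA. Qed.
Let scale1 : left_id 1 scale.
Proof. by move=> x; rewrite -[x]piK scale_pi scale1r. Qed.
Let scaleDr : right_distributive scale +%R.
Proof.
by move=> k x y; rewrite -[x]piK -[y]piK !(scale_pi, =^~ piD) scalerDr.
Qed.
Let scaleDl x : {morph scale^~ x : a b / a + b}.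
Proof. by move=> a b; rewrite -[x]piK !scale_pi scalerDl piD. Qed.

HB.instance Definition _ :=
  GRing.Zmodule_isLmodule.Build K quotv scaleA scale1 scaleDr scaleDl.

Fact quotv_pi_is_linear : linear quotv_pi.
Proof. by move=> k u v; rewrite piD -scale_pi. Qed.

HB.instance Definition _ :=
  GRing.isLinear.Build K V quotv _ quotv_pi quotv_pi_is_linear.

End QuotientSpace.

(* The homology of a vector space A with an endomorphism D such that D^2 = 0. *)
Section Homology.
Variables (K : fieldType) (A : vectType K) (D : 'End(A)).

Definition cycles : vectType K := subvs_of (lker D).

Definition boundaries : {vspace cycles} :=
  (linfun (vsval : cycles -> A) @^-1: limg D)%VS.

(* When D^2 = 0, this is lker D modulo limg D.                                *)
Definition homology : lmodType K := quotv boundaries.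

Definition hclass (z : cycles) : homology := quotv_pi boundaries z.

End Homology.

Section BigradedAlgebras.
Variables (K : fieldType) (A : lmodType K).
Variables (gr : nat -> nat -> A -> Prop) (one : A) (mul : A -> A -> A).

Record is_bigraded_algebra : Prop := IsBigradedAlgebra {
  gr_submod : forall p q, gr p q 0 /\
    forall (k : K) x y, gr p q x -> gr p q y -> gr p q (k *: x + y);
  gr_span : forall x, exists N (c : nat -> nat -> A),
    (forall p q, gr p q (c p q)) /\ x = \sum_(p < N) \sum_(q < N) c p q;
  gr_direct : forall N (c : nat -> nat -> A),
    (forall p q, gr p q (c p q)) -> \sum_(p < N) \sum_(q < N) c p q = 0 ->
    forall p q, (p < N)%N -> (q < N)%N -> c p q = 0;
  mul_linearl : forall y, linear (mul^~ y);
  mul_linearr : forall x, linear (mul x);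
  mul_assoc : associative mul;
  mul_one_l : left_id one mul;
  mul_one_r : right_id one mul;
  gr_one : gr 0%N 0%N one;
  gr_mul : forall p q p' q' x y,
    gr p q x -> gr p' q' y -> gr (p + p')%N (q + q')%N (mul x y)
}.

(* The second degree is the homological one.                                  *)
Record is_dga (D : A -> A) : Prop := IsDGA {
  dga_algebra : is_bigraded_algebra;
  dga_linear : linear D;
  dga_degree : forall p q x, gr p q x -> gr p q.+1 (D x);
  dga_square : forall x, D (D x) = 0;
  dga_leibniz : forall p q x y, gr p q x ->
    D (mul x y) = mul (D x) y + (-1) ^+ q *: mul x (D y)
}.

End BigradedAlgebras.

Section HomologyAlgebra.
Variables (K : fieldType) (A : vectType K) (D : 'End(A)).
Variables (gr : nat -> nat -> A -> Prop) (one : A) (mul : A -> A -> A).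

Definition homology_gr p q (h : homology D) : Prop :=
  exists2 z : cycles D, gr p q (vsval z) & h = hclass z.

(* hone and hmul are induced by one and mul on cycles.                        *)
Definition induced_one (hone : homology D) : Prop :=
  exists2 z : cycles D, vsval z = one & hone = hclass z.

Definition induced_mul (hmul : homology D -> homology D -> homology D) : Prop :=
  forall z w : cycles D,
    exists2 t : cycles D, vsval t = mul (vsval z) (vsval w)
                        & hmul (hclass z) (hclass w) = hclass t.

End HomologyAlgebra.

(* In this generality, an inner product is a symmetric bilinear form; its     *)
(* nondegeneracy, on the whole space as on the other flats, is assumed with   *)
(* nondegenerate_on.                                                          *)
Record vector_arrangement (K : fieldType) (n : nat) := VectorArrangement {
  va_space : vectType K;
  va_form : {symmetric va_space};
  va_vec : 'I_n -> va_space
}.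

Section OrthogonalProjection.
Variables (K : fieldType) (V : vectType K) (form : {symmetric V}).

(* The radical of the restriction of form to W is zero.                       *)
Definition nondegenerate_on (W : {vspace V}) : Prop :=
  (W :&: orthov form W = 0)%VS.

(* The orthogonal projection to W when form is nondegenerate on W: see oprojP. *)
Definition oproj (W : {vspace V}) (v : V) : subvs_of W :=
  Subvs (memv_pi W (orthov form W) v).

Fact oproj_is_linear W : linear (oproj W).
Proof. by move=> k u v; apply: val_inj; rewrite /= linearP. Qed.

HB.instance Definition _ W :=
  GRing.isLinear.Build K V (subvs_of W) _ (oproj W) (oproj_is_linear W).

Lemma oprojP W : nondegenerate_on W ->
  forall v, v - vsval (oproj W v) \in orthov form W.
Proof.
move=> ndW v; pose f0 (u : V) : 'rV[K]_(\dim W) := \row_i form u (vbasis W)`_i.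
have f0l : linear f0.
  by move=> k u w; apply/rowP=> i; rewrite !mxE linearPl.
pose f1 : {linear V -> 'rV[K]_(\dim W)} :=
  HB.pack f0 (GRing.isLinear.Build K V _ _ f0 f0l).
pose f := linfun f1.
have kerf u : f u = 0 -> u \in orthov form W.
  rewrite lfunE => /rowP fu0; apply/mem_orthovP => w /coord_vbasis->.
  rewrite linear_sumr big1 // => i _; rewrite linearZr /=.
  by have := fu0 i; rewrite !mxE => ->; rewrite mulr0.
have fW : (f @: W)%VS = fullv.
  have := limg_ker_dim f W; suff -> : (W :&: lker f)%VS = 0%VS.
    by rewrite dimv0 add0n => dW; apply/eqP; rewrite eqEdim subvf dW dimvf
      /dim /= mul1n leqnn.
  apply/eqP; rewrite -subv0 -ndW; apply/subvP=> u.
  by rewrite !memv_cap memv_ker => /andP[-> /eqP/kerf].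
have /memv_imgP[w wW fvw] : f v \in (f @: W)%VS by rewrite fW memvf.
have vw : v - w \in orthov form W by apply: kerf; rewrite linearB /= fvw subrr.
have -> : v - vsval (oproj W v) = daddv_pi (orthov form W) W v.
  apply/eqP; rewrite subr_eq addrC daddv_pi_add //.
  by rewrite -[v](addrNK w) addrC memv_add.
exact: memv_pi.
Qed.

End OrthogonalProjection.

Section Inclusion.
Variables (K : fieldType) (V : vectType K) (U W : {vspace V}).
Hypothesis sUW : (U <= W)%VS.

Definition vincl (u : subvs_of U) : subvs_of W :=
  Subvs (subvP sUW _ (subvsP u)).

Fact vincl_is_linear : linear vincl.
Proof. by move=> k u v; apply: val_inj. Qed.

HB.instance Definition _ :=
  GRing.isLinear.Build K (subvs_of U) (subvs_of W) _ vincl vincl_is_linear.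

End Inclusion.

Definition ext_map (K : fieldType) (V W : vectType K) (f : {linear V -> W}) :
  ext V -> ext W := ext_lift (@ext_inj K W \o f).

HB.instance Definition _ (K : fieldType) (V W : vectType K)
  (f : {linear V -> W}) := GRing.Linear.copy (ext_map f) (ext_lift _).

Section Complex.
Variables (K : fieldType) (n : nat) (A : vector_arrangement K n).
Local Notation V := (va_space A).
Local Notation form := (@va_form K n A).
Local Notation nu := (@va_vec K n A).
Implicit Types S T : {set 'I_n}.

Definition hyperplane (i : 'I_n) : {vspace V} := orthov form <[nu i]>.

Definition flat S : {vspace V} := (\bigcap_(s in S) hyperplane s)%VS.

Fact flatD1 S s : (flat S <= flat (S :\ s))%VS.
Proof.
apply/subv_bigcapP=> i /setD1P[_ iS].
by rewrite /flat (bigD1 i) //= capvSl.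
Qed.

Definition extflat S : vectType K := ext (subvs_of (flat S)).

Definition cplx : vectType K := dirsum extflat.

(* The bidegree of the degree i part of the exterior algebra of flat S is     *)
(* (#|S| + i, i).                                                             *)
Definition cplx_gr (p q : nat) (c : cplx) : Prop :=
  forall S,
    if (#|S| + q == p)%N then ext_homog q (c S : ext (subvs_of (flat S)))
    else c S = 0.

Definition dcomp S (s : 'I_n) (x : ext (subvs_of (flat S))) :
  ext (subvs_of (flat (S :\ s))) :=
  ext_inj (oproj form (flat (S :\ s)) (nu s)) * ext_map (vincl (flatD1 S s)) x.

Definition diff_fun (c : cplx) : cplx :=
  \sum_(S : {set 'I_n}) \sum_(s in S) dirsum_inj (T := extflat) (dcomp s (c S)).

Fact dcomp_is_linear S s : linear (@dcomp S s).
Proof. by move=> k x y; rewrite /dcomp linearP mulrDr -scalerAr. Qed.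

HB.instance Definition _ S s :=
  GRing.isLinear.Build K (ext (subvs_of (flat S)))
    (ext (subvs_of (flat (S :\ s)))) _ (@dcomp S s) (@dcomp_is_linear S s).

Fact diff_is_linear : linear diff_fun.
Proof.
move=> k c c'; rewrite /diff_fun scaler_sumr -big_split; apply: eq_bigr => S _.
rewrite scaler_sumr -big_split; apply: eq_bigr => s _.
by rewrite dirsum_addE dirsum_scaleE !linearP.
Qed.

HB.instance Definition _ :=
  GRing.isLinear.Build K cplx cplx _ diff_fun diff_is_linear.

Definition diff : 'End(cplx) := linfun diff_fun.

Definition ext_oproj S T : ext (subvs_of (flat S)) -> ext (subvs_of (flat T)) :=
  ext_map (oproj form (flat T) \o vsval).

Definition mcomp S T (x : ext (subvs_of (flat S))) (y : ext (subvs_of (flat T)))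
  : ext (subvs_of (flat (S :|: T))) :=
  ext_oproj (S :|: T) x * ext_oproj (S :|: T) y.

(* The product of the summands of indices S and T is 0 if S and T meet.       *)
Definition cplx_mul (c c' : cplx) : cplx :=
  \sum_(S : {set 'I_n}) \sum_(T : {set 'I_n} | [disjoint S & T])
    dirsum_inj (T := extflat) (mcomp (c S) (c' T)).

Definition cplx_one : cplx :=
  dirsum_inj (T := extflat) (1 : ext (subvs_of (flat set0))).

End Complex.

(* Main.v *)
From HB Require Import structures.
Require Import Defs.
From mathcomp Require Import all_boot all_order all_algebra.

Set Implicit Arguments.
Unset Strict Implicit.
Unset Printing Implicit Defensive.

Import GRing.Theory.

(** The summand C_S is the exterior algebra of the flat H_S. The differential
    wedges a form, included in the forms of a larger flat, with a projection of
    nu_s to that flat; the product wedges projections of two forms to a smaller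
    flat. Three facts about orthogonal projections carry the proof.

    - Tower: projecting to a flat, then to a smaller one, is projecting to the
      smaller one (oproj_tower). This gives associativity.
    - nu_s projects to 0 on every flat H_S with s in S, because it is orthogonal
      to H_s (flatproj_nu). This kills the terms of the Leibniz rule indexed by
      sets that meet, where the left-hand side vanishes too.
    - If s is in S and W is the flat of S minus s, then for every vector v the
      projections of v to W and to H_S, which is the hyperplane of W orthogonal
      to nu_s, differ by a multiple of the projection e of nu_s to W
      (oproj_hyperplane). Hence e wedge p_W(x) = e wedge p_S(x) for every
      form x (wedge_proj).

    By the last fact, dd is a sum over pairs s, t of wedges of the projections
    of nu_s and nu_t to a common flat; exchanging s and t changes the sign, so
    the sum vanishes. In the Leibniz rule it lets the projection to the flat of
    the union of S and T be replaced by the projection to the flat where the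
    differential lands; the terms with s in S are then immediate, and those
    with s in T acquire the sign of moving a vector past a form of degree q.

    The flats of index (S minus s) union T and (S union T) minus s are equal
    but their types are not convertible. Equalities between summands are
    therefore tested after embedding every summand in the exterior algebra of
    V, by a map which is injective since the projection is a left inverse
    (emb_inj, cplx_inj_eq).

    The passage to homology holds for every differential graded algebra. The
    sign in the Leibniz rule depends on the degree, so that inhomogeneous
    cycles must first be split into homogeneous parts, which are again cycles
    since the differential shifts degrees (homog_cycle). *)

(** * Exterior algebras: induction and grading *)

Section ExteriorInduction.
Local Open Scope ring_scope.
Variables (K : fieldType) (V : vectType K).
Implicit Types (x y : ext V) (v w : V).

(** Products of vectors span the exterior algebra: identities between linear
    maps need only be carried through a product by one more vector. *)
Lemma ext_ind (P : ext V -> Prop) :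
    (forall k x y, P x -> P y -> P (k *: x + y)) -> P 1 ->
    (forall v x, P x -> P (ext_inj v * x)) ->
  forall x, P x.
Proof.
move=> Plin P1 Pmul x.
have P0 : P 0 by rewrite -(addNr 1) -scaleN1r; apply: Plin.
rewrite (ext_sum_basis x); elim/big_ind: _ => // [y z Py Pz|I _].
  by rewrite -[y]scale1r; apply: Plin.
rewrite -[_ *: _]addr0; apply: Plin => //; rewrite ext_basis_prod.
elim: (enum _) => [|i s IHs]; first by rewrite big_nil.
by rewrite big_cons -ext_inj_basis; apply: Pmul.
Qed.

Lemma ext_injC v w : ext_inj v * ext_inj w = - (ext_inj w * ext_inj v).
Proof.
apply/eqP; rewrite -addr_eq0; have := ext_inj_sqr (v + w).
rewrite linearD mulrDl !mulrDr !ext_inj_sqr add0r addr0 => /eqP.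
by [].
Qed.

End ExteriorInduction.

Section ExteriorGrading.
Local Open Scope ring_scope.
Variables (K : fieldType) (V : vectType K).
Implicit Types (x y : ext V) (v w : V).

Lemma ext_homog0 q : ext_homog q (0 : ext V).
Proof. by move=> I; rewrite ffunE eqxx. Qed.

Lemma ext_homog_lin q k x y :
  ext_homog q x -> ext_homog q y -> ext_homog q (k *: x + y).
Proof.
move=> hx hy I; rewrite !ffunE => nz.
have [xI|/hx//] := eqVneq (x I) 0; apply: hy.
by move: nz; rewrite xI scaler0 add0r.
Qed.

Lemma ext_homog_sum q (J : finType) (P : pred J) (F : J -> ext V) :
  (forall j, P j -> ext_homog q (F j)) -> ext_homog q (\sum_(j | P j) F j).
Proof.
move=> hF; elim/big_ind: _ => //; first exact: ext_homog0.
by move=> x y hx hy; rewrite -[x]scale1r; apply: ext_homog_lin.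
Qed.

Lemma ext_homog_basis (I : {set 'I_(\dim {:V})}) :
  ext_homog #|I| (ext_basis I : ext V).
Proof.
by move=> J; rewrite ffunE; have [->|_] := eqVneq J I; rewrite ?eqxx.
Qed.

Lemma ext_homogM q q' x y :
  ext_homog q x -> ext_homog q' y -> ext_homog (q + q') (x * y).
Proof.
move=> hx hy; rewrite -[x * y]/(ext_mul x y) /ext_mul.
apply: ext_homog_sum => I _; apply: ext_homog_sum => J dIJ.
have [xI|/hx <-] := eqVneq (x I) 0.
  by rewrite xI mul0r mulr0 scale0r; apply: ext_homog0.
have [yJ|/hy <-] := eqVneq (y J) 0.
  by rewrite yJ !mulr0 scale0r; apply: ext_homog0.
rewrite -[_ *: _]addr0; apply: ext_homog_lin; last exact: ext_homog0.
by rewrite -cardsUI disjoint_setI0 // cards0 addn0; apply: ext_homog_basis.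
Qed.

Lemma ext_homog_inj v : ext_homog 1 (ext_inj v).
Proof.
apply: ext_homog_sum => i _; rewrite -[_ *: _]addr0.
apply: ext_homog_lin; last exact: ext_homog0.
by rewrite -[1%N](cards1 i); apply: ext_homog_basis.
Qed.

Lemma ext_homog1 : ext_homog 0 (1 : ext V).
Proof. by rewrite -(cards0 'I_(\dim {:V})); apply: ext_homog_basis. Qed.

Lemma ext_homog_le q x : ext_homog q x -> x != 0 -> (q <= \dim {:V})%N.
Proof.
move=> hx; apply: contraNT; rewrite -ltnNge => lt_dq.
apply/eqP/ffunP => I; rewrite ffunE; apply/eqP; apply: contraLR lt_dq => /hx <-.
by rewrite -leqNgt -[leqRHS]card_ord max_card.
Qed.

Definition ext_part (q : nat) x : ext V :=
  [ffun I : {set 'I_(\dim {:V})} => if #|I| == q then x I else 0].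

Lemma ext_part_homog q x : ext_homog q (ext_part q x).
Proof.
by move=> I; rewrite ffunE; have [|_] := eqVneq #|I| q; rewrite ?eqxx.
Qed.

Lemma ext_sum_part N x : (\dim {:V} < N)%N -> \sum_(q < N) ext_part q x = x.
Proof.
move=> ltN; apply/ffunP => I; rewrite sum_ffunE.
have ltI : (#|I| < N)%N.
  by apply: leq_ltn_trans ltN; rewrite -[leqRHS]card_ord max_card.
rewrite (bigD1 (Ordinal ltI)) //= ffunE eqxx big1 ?addr0 // => q.
by rewrite -val_eqE /= ffunE eq_sym => /negPf->.
Qed.

(** The degrees below N are independent: the coordinate at I survives only in
    the summand of degree #|I|. *)
Lemma ext_homog_uniq N (F : nat -> ext V) q :
    (forall r, ext_homog r (F r)) -> (q < N)%N ->
  \sum_(r < N) F r = 0 -> F q = 0.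
Proof.
move=> hF ltq sF; apply/ffunP => I; rewrite ffunE.
have [/hF cI|/negPn/eqP//] := boolP (F q I != 0).
have /ffunP/(_ I) := sF; rewrite sum_ffunE ffunE (bigD1 (Ordinal ltq)) //=.
rewrite big1 ?addr0 // => r; rewrite -val_eqE /= => nrq.
apply: contraNeq nrq => /hF <-; exact/eqP.
Qed.

(** A vector anticommutes with each of the q factors of a form of degree q. *)
Lemma ext_inj_homogC q v x :
  ext_homog q x -> ext_inj v * x = (-1) ^+ q *: (x * ext_inj v).
Proof.
move=> hx; rewrite {1 2}(ext_sum_basis x) mulr_sumr mulr_suml scaler_sumr.
apply: eq_bigr => I _; have [->|/hx <-] := eqVneq (x I) 0.
  by rewrite !scale0r mulr0 mul0r scaler0.
rewrite -scalerAr -scalerAl scalerA mulrC -scalerA; congr (_ *: _).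
rewrite ext_basis_prod cardE; elim: (enum _) => [|i s IHs] /=.
  by rewrite big_nil mulr1 mul1r scale1r.
rewrite !big_cons -ext_inj_basis mulrA ext_injC mulNr -mulrA IHs.
by rewrite -scalerAr mulrA exprS mulN1r scaleNr.
Qed.

End ExteriorGrading.

(** * Functoriality of exterior algebras *)

Section ExteriorFunctor.
Local Open Scope ring_scope.
Variable K : fieldType.
Implicit Types U V W : vectType K.

Lemma ext_map_inj V W (f : {linear V -> W}) v :
  ext_map f (ext_inj v) = ext_inj (f v).
Proof.
have [E _ _ _] :=
  ext_universal (g := @ext_inj K W \o f) (fun u => ext_inj_sqr (f u)).
exact: E.
Qed.

Lemma ext_map1 V W (f : {linear V -> W}) : ext_map f 1 = 1.
Proof.
have [_ E _ _] :=
  ext_universal (g := @ext_inj K W \o f) (fun u => ext_inj_sqr (f u)).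
exact: E.
Qed.

Lemma ext_mapM V W (f : {linear V -> W}) : {morph ext_map f : x y / x * y}.
Proof.
have [_ _ E _] :=
  ext_universal (g := @ext_inj K W \o f) (fun u => ext_inj_sqr (f u)).
exact: E.
Qed.

Lemma eq_ext_map V W (f g : {linear V -> W}) : f =1 g -> ext_map f =1 ext_map g.
Proof.
move=> fg; apply: ext_ind => [k x y IHx IHy||v x IHx].
- by rewrite !linearP /= IHx IHy.
- by rewrite !ext_map1.
- by rewrite !ext_mapM !ext_map_inj IHx fg.
Qed.

Lemma ext_map_comp U V W (g : {linear V -> W}) (f : {linear U -> V}) x :
  ext_map g (ext_map f x) = ext_map (g \o f) x.
Proof.
elim/ext_ind: x => [k x y IHx IHy||v x IHx].
- by rewrite !linearP /= IHx IHy.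
- by rewrite !ext_map1.
- by rewrite !ext_mapM !ext_map_inj IHx.
Qed.

Lemma ext_map_id V (f : {linear V -> V}) : f =1 id -> ext_map f =1 id.
Proof.
move=> fid; apply: ext_ind => [k x y IHx IHy||v x IHx].
- by rewrite !linearP /= IHx IHy.
- by rewrite !ext_map1.
- by rewrite !ext_mapM !ext_map_inj IHx fid.
Qed.

(** The maps induced by f and g agree modulo the ideal generated by e, and
    wedging with e annihilates that ideal. *)
Lemma ext_map_wedge V W (f g : {linear V -> W}) (e : W) :
    (forall v, f v - g v \in <[e]>%VS) ->
  forall x, ext_inj e * ext_map f x = ext_inj e * ext_map g x.
Proof.
move=> fg; apply: ext_ind => [k x y IHx IHy||v x IHx].
- by rewrite !linearP /= !mulrDr -!scalerAr IHx IHy.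
- by rewrite !ext_map1.
rewrite !ext_mapM !ext_map_inj !mulrA.
have -> : ext_inj e * ext_inj (f v) = ext_inj e * ext_inj (g v).
  have /vlineP[k fgk] := fg v; rewrite -[f v](subrK (g v)) fgk linearP mulrDr.
  by rewrite -scalerAr ext_inj_sqr scaler0 add0r.
by rewrite ext_injC !mulNr -!mulrA IHx.
Qed.

Lemma ext_map_homog V W (f : {linear V -> W}) q x :
  ext_homog q x -> ext_homog q (ext_map f x).
Proof.
move=> hx; rewrite {1}(ext_sum_basis x) linear_sum; apply: ext_homog_sum => I _.
rewrite linearZ /=; have [->|/hx <-] := eqVneq (x I) 0.
  by rewrite scale0r; apply: ext_homog0.
rewrite -[_ *: _]addr0; apply: ext_homog_lin; last exact: ext_homog0.
rewrite ext_basis_prod cardE; elim: (enum _) => [|i s IHs] /=.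
  by rewrite big_nil ext_map1; apply: ext_homog1.
rewrite big_cons -ext_inj_basis ext_mapM ext_map_inj -add1n.
by apply: ext_homogM => //; apply: ext_homog_inj.
Qed.

End ExteriorFunctor.

(** * Orthogonal projections *)

Section OrthogonalProjections.
Local Open Scope ring_scope.
Variables (K : fieldType) (V : vectType K) (form : {symmetric V}).
Implicit Types (U W : {vspace V}) (v w : V).
Local Notation perp W := (orthov form W).

Lemma perpS U W v : (U <= W)%VS -> v \in perp W -> v \in perp U.
Proof.
move=> sUW /mem_orthovP vW; apply/mem_orthovP => u uU.
by apply: vW; apply: (subvP sUW).
Qed.

Lemma nondegenerate_eq0 W v :
  nondegenerate_on form W -> v \in W -> v \in perp W -> v = 0.
Proof.
by move=> ndW vW vP; apply/eqP; rewrite -memv0 -ndW memv_cap vW.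
Qed.

Lemma oproj_uniq W v w : nondegenerate_on form W ->
  w \in W -> v - w \in perp W -> vsval (oproj form W v) = w.
Proof.
move=> ndW wW vwP; apply/eqP; rewrite -subr_eq0; apply/eqP.
apply: (nondegenerate_eq0 ndW); first by rewrite rpredB ?subvsP.
have -> : vsval (oproj form W v) - w = (v - w) - (v - vsval (oproj form W v)).
  by rewrite opprB [RHS]addrC subrKA.
by rewrite rpredB ?oprojP.
Qed.

Lemma oproj_vsval W (u : subvs_of W) :
  nondegenerate_on form W -> oproj form W (vsval u) = u.
Proof.
move=> ndW; apply: val_inj; apply: oproj_uniq; rewrite ?subvsP //.
by rewrite subrr mem0v.
Qed.

Lemma oproj_perp W v :
  nondegenerate_on form W -> v \in perp W -> oproj form W v = 0.
Proof.
move=> ndW vP; apply: val_inj; apply: oproj_uniq; rewrite ?mem0v //.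
by rewrite subr0.
Qed.

Lemma oproj_tower U W v : (U <= W)%VS ->
    nondegenerate_on form U -> nondegenerate_on form W ->
  oproj form U (vsval (oproj form W v)) = oproj form U v.
Proof.
move=> sUW ndU ndW; apply: val_inj; apply: oproj_uniq; rewrite ?subvsP //.
have -> : vsval (oproj form W v) - vsval (oproj form U v) =
    (v - vsval (oproj form U v)) - (v - vsval (oproj form W v)).
  by rewrite opprB [RHS]addrC subrKA.
by rewrite rpredB ?oprojP // (perpS sUW) ?oprojP.
Qed.

(** The difference d of the two projections lies in W and is orthogonal to U.
    With b the projection of a to W, U is the subspace of W orthogonal to b, so
    d should be a multiple of b. If b is isotropic then it lies in U and is
    orthogonal to U, hence b = 0 by nondegeneracy, U = W and d = 0. Otherwise
    subtract from d its component along b: the result lies in U and is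
    orthogonal to U. *)
Lemma oproj_hyperplane U W a v : U = (W :&: perp <[a]>)%VS ->
    nondegenerate_on form U -> nondegenerate_on form W ->
  vsval (oproj form W v) - vsval (oproj form U v)
    \in <[vsval (oproj form W a)]>%VS.
Proof.
move=> defU ndU ndW; pose b := vsval (oproj form W a).
have sUW : (U <= W)%VS by rewrite defU capvSl.
have bW : b \in W by apply: subvsP.
have WbU w : w \in W -> form w b = 0 -> w \in U.
  move=> wW wb0; rewrite defU memv_cap wW mem_orthov1.
  have /mem_orthovP/(_ w wW)/eqP := oprojP ndW a.
  rewrite herm_eq0C linearBr /= -/b wb0 subr0 => wa; exact: wa.
have bU : b \in perp U.
  apply/mem_orthovP => u uU; apply/eqP; rewrite herm_eq0C.
  have := uU; rewrite defU memv_cap mem_orthov1 => /andP[uW /eqP ua].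
  have /mem_orthovP/(_ u uW)/eqP := oprojP ndW a.
  by rewrite herm_eq0C linearBr /= ua sub0r oppr_eq0.
set d := (X in X \in _).
have dW : d \in W by rewrite rpredB ?subvsP // (subvP sUW) ?subvsP.
have dU : d \in perp U.
  rewrite /d -(oproj_tower v sUW ndU ndW); exact: oprojP.
have [bb0|nbb] := eqVneq (form b b) 0.
  have b0 : b = 0 by apply: (nondegenerate_eq0 ndU) => //; apply: WbU.
  suff -> : d = 0 by apply: mem0v.
  apply: (nondegenerate_eq0 ndU) => //; apply: WbU => //.
  by rewrite b0 linear0r.
apply/vlineP; exists (form d b / form b b); apply/eqP; rewrite -subr_eq0.
apply/eqP; apply: (nondegenerate_eq0 ndU).
  apply: WbU; first by rewrite rpredB ?rpredZ.
  by rewrite linearBl linearZl_LR /= divfK ?subrr.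
by rewrite rpredB ?rpredZ.
Qed.

End OrthogonalProjections.

Section Flats.
Local Open Scope ring_scope.
Variables (K : fieldType) (n : nat) (A : vector_arrangement K n).
Local Notation form := (va_form A).
Local Notation nu := (@va_vec K n A).
Implicit Types S T : {set 'I_n}.

Lemma flatS S T : S \subset T -> (flat A T <= flat A S)%VS.
Proof.
move=> sST; apply/subv_bigcapP => i iS.
by rewrite /flat (bigD1 i) ?(subsetP sST) //= capvSl.
Qed.

Lemma flat_setD1 S s : s \in S ->
  flat A S = (flat A (S :\ s) :&: orthov form <[nu s]>)%VS.
Proof. by move=> sS; rewrite /flat (big_setD1 s sS) capvC. Qed.

Lemma nu_perp S s : s \in S -> nu s \in orthov form (flat A S).
Proof.
move=> sS; rewrite mem_orthov_sym; apply: (@subv_trans _ _ (flat A [set s])).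
  by apply: flatS; rewrite sub1set.
by rewrite /flat big_set1.
Qed.

End Flats.

(** * Summands of the complex, embedded in the exterior algebra of V *)

Lemma setD1_setUl (T : finType) (A B : {set T}) x :
  x \notin B -> A :\ x :|: B = (A :|: B) :\ x.
Proof.
move=> nxB; rewrite setDUl; congr (_ :|: _); apply/esym/setDidPl.
by rewrite disjoint_sym disjoints1.
Qed.

Section Summands.
Local Open Scope ring_scope.
Variables (K : fieldType) (n : nat) (A : vector_arrangement K n).
Hypothesis nd : forall S : {set 'I_n}, nondegenerate_on (va_form A) (flat A S).
Local Notation V := (va_space A).
Local Notation form := (va_form A).
Local Notation nu := (@va_vec K n A).
Local Notation C S := (ext (subvs_of (flat A S))).
Implicit Types S T : {set 'I_n}.

(** Values in one common algebra make summands with different, possibly only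
    provably equal, index sets comparable. *)
Definition emb S (x : C S) : ext V := ext_map vsval x.

HB.instance Definition _ S := GRing.Linear.copy (@emb S) (ext_map _).

Definition flatproj S : V -> V := vsval \o oproj form (flat A S).

HB.instance Definition _ S := GRing.Linear.copy (flatproj S)
  (vsval \o oproj form (flat A S)).

Lemma flatprojE S v : flatproj S v = vsval (oproj form (flat A S) v).
Proof. by []. Qed.

Local Notation proj S := (ext_map (flatproj S)).

Lemma flatproj_tower S T v :
  S \subset T -> flatproj T (flatproj S v) = flatproj T v.
Proof. by move=> sST; rewrite flatprojE oproj_tower //; apply: flatS. Qed.

Lemma proj_tower S T x : S \subset T -> proj T (proj S x) = proj T x.
Proof.
move=> sST; rewrite ext_map_comp; apply: eq_ext_map => v /=.
exact: flatproj_tower.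
Qed.

Lemma emb_inj S : injective (@emb S).
Proof.
apply: (can_inj (g := ext_map (oproj form (flat A S)))) => x.
by rewrite /emb ext_map_comp ext_map_id // => u /=; apply: oproj_vsval.
Qed.

Lemma proj_emb S (x : C S) : proj S (emb x) = emb x.
Proof.
rewrite /emb ext_map_comp; apply: eq_ext_map => u /=.
by rewrite flatprojE oproj_vsval.
Qed.

Lemma emb_dcomp S s (x : C S) :
  emb (dcomp s x) = ext_inj (flatproj (S :\ s) (nu s)) * emb x.
Proof.
rewrite /emb /dcomp ext_mapM ext_map_inj ext_map_comp.
by congr (_ * _); apply: eq_ext_map.
Qed.

Lemma emb_mcomp S T (x : C S) (y : C T) :
  emb (mcomp x y) = proj (S :|: T) (emb x * emb y).
Proof.
rewrite /emb /mcomp /ext_oproj !ext_mapM !ext_map_comp.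
by congr (_ * _); apply: eq_ext_map.
Qed.

Lemma flatproj_nu S s : s \in S -> flatproj S (nu s) = 0.
Proof. by move=> sS; rewrite flatprojE oproj_perp ?linear0 ?nu_perp. Qed.

(** Once the projection of nu s is wedged on the left, projecting to the flat
    of S or to the flat of S minus s makes no difference. *)
Lemma wedge_proj S s x : s \in S ->
  ext_inj (flatproj (S :\ s) (nu s)) * proj S x =
  ext_inj (flatproj (S :\ s) (nu s)) * proj (S :\ s) x.
Proof.
move=> sS; apply/esym/ext_map_wedge => v; apply: oproj_hyperplane => //.
exact: flat_setD1.
Qed.

(** Both composites wedge with the projections of nu s and nu t to the flat of
    S minus s and t, in opposite orders. *)
Lemma emb_dcompC S s t (x : C S) : s \in S -> t \in S -> s != t ->
  emb (dcomp t (dcomp s x)) = - emb (dcomp s (dcomp t x)).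
Proof.
have expand s' t' : s' \in S -> t' \in S -> s' != t' ->
    emb (dcomp t' (dcomp s' x)) =
    ext_inj (flatproj (S :\ s' :\ t') (nu t'))
      * ext_inj (flatproj (S :\ s' :\ t') (nu s')) * emb x.
  move=> s'S t'S nst; have t'S' : t' \in S :\ s' by rewrite !inE eq_sym nst.
  (* Trade the inner projection, to S minus s', for one to the final flat. *)
  have := wedge_proj (ext_inj (nu s')) t'S'; rewrite !ext_map_inj => wst.
  by rewrite !emb_dcomp mulrA wst.
move=> sS tS nst; rewrite (expand s t) // (expand t s) // 1?eq_sym //.
rewrite ext_injC mulNr.
by rewrite !setDDl [_ |: _]setUC.
Qed.

Lemma emb_dcomp_mcompl S T s (x : C S) (y : C T) : s \in S -> s \notin T ->
  emb (dcomp s (mcomp x y)) = emb (mcomp (dcomp s x) y).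
Proof.
move=> sS nsT.
have defW := setD1_setUl S nsT.
rewrite emb_dcomp !emb_mcomp wedge_proj ?inE ?sS // emb_dcomp defW.
rewrite -mulrA [in RHS]ext_mapM ext_map_inj /= flatproj_tower //.
by rewrite -defW subsetUl.
Qed.

(** Here the projection of nu s has to move past x, of degree q. *)
Lemma emb_dcomp_mcompr S T s q (x : C S) (y : C T) : ext_homog q x ->
    s \in T -> s \notin S ->
  emb (dcomp s (mcomp x y)) = (-1) ^+ q *: emb (mcomp x (dcomp s y)).
Proof.
move=> hx sT nsS.
have defW : S :|: T :\ s = (S :|: T) :\ s.
  by rewrite setUC setD1_setUl // setUC.
rewrite emb_dcomp !emb_mcomp wedge_proj ?inE ?sT ?orbT // emb_dcomp defW.
rewrite -linearZ /= mulrA scalerAl -ext_inj_homogC; last exact: ext_map_homog.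
rewrite -mulrA [in RHS]ext_mapM ext_map_inj /= flatproj_tower //.
by rewrite -defW subsetUr.
Qed.

(** As s stays in the union of S minus s and T, the vector nu s that the
    differential wedges in is projected to 0 by the product. *)
Lemma mcomp_dcomp0 S T s (x : C S) (y : C T) :
  s \in S -> s \in T -> mcomp (dcomp s x) y = 0.
Proof.
move=> sS sT; apply: emb_inj; rewrite linear0 emb_mcomp emb_dcomp -mulrA.
rewrite ext_mapM ext_map_inj /= flatproj_tower; last first.
  by rewrite subsetUl.
by rewrite flatproj_nu ?linear0 ?mul0r // !inE sT orbT.
Qed.

Lemma mcomp_dcompr0 S T s (x : C S) (y : C T) :
  s \in S -> s \in T -> mcomp x (dcomp s y) = 0.
Proof.
move=> sS sT; apply: emb_inj; rewrite linear0 emb_mcomp emb_dcomp.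
rewrite !ext_mapM ext_map_inj /= flatproj_tower; last by rewrite subsetUr.
by rewrite flatproj_nu ?linear0 ?mul0r ?mulr0 // !inE sS.
Qed.

Lemma emb_mcompA S T U (x : C S) (y : C T) (z : C U) :
  emb (mcomp x (mcomp y z)) = emb (mcomp (mcomp x y) z).
Proof.
rewrite !emb_mcomp !ext_mapM !proj_tower ?subsetUl ?subsetUr //.
all: by rewrite ?setUA ?mulrA // -?setUA ?subsetUr // setUA subsetUl.
Qed.

Lemma emb_mcomp1l S (x : C S) : emb (mcomp (1 : C set0) x) = emb x.
Proof. by rewrite emb_mcomp /emb ext_map1 mul1r set0U -/(emb x) proj_emb. Qed.

Lemma emb_mcomp1r S (x : C S) : emb (mcomp x (1 : C set0)) = emb x.
Proof. by rewrite emb_mcomp /emb ext_map1 mulr1 setU0 -/(emb x) proj_emb. Qed.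

End Summands.

(** * The complex is a differential graded algebra *)

Section Complex.
Local Open Scope ring_scope.
Variables (K : fieldType) (n : nat) (A : vector_arrangement K n).
Local Notation V := (va_space A).
Local Notation C S := (ext (subvs_of (flat A S))).
Local Notation inj := (dirsum_inj (T := extflat A)).
Local Notation mul := (@cplx_mul K n A).
Local Notation D := (@diff_fun K n A).
Implicit Types (S T : {set 'I_n}) (c d e : cplx A).

Lemma cplx_injE S (x : C S) T :
  (inj x : cplx A) T = dfwith (fun R => 0 : extflat A R) (x : extflat A S) T.
Proof. by rewrite ffunE. Qed.

Lemma cplx_inj_in S (x : C S) : (inj x : cplx A) S = x.
Proof. by rewrite cplx_injE dfwith_in. Qed.

Lemma cplx_inj_out S (x : C S) T : S != T -> (inj x : cplx A) T = 0.
Proof. by move=> nST; rewrite cplx_injE dfwith_out. Qed.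

Lemma cplx_sumE (J : finType) (P : pred J) (F : J -> cplx A) T :
  (\sum_(j | P j) F j) T = \sum_(j | P j) F j T.
Proof.
by elim/big_rec2: _ => [|j c x _ <-]; rewrite ?dirsum_0E ?dirsum_addE.
Qed.

Lemma cplx_sum_inj c : c = \sum_S inj (c S : C S).
Proof.
apply/ffunP => T; rewrite cplx_sumE (bigD1 T) //= cplx_inj_in big1 ?addr0 //.
by move=> S nST; rewrite cplx_inj_out.
Qed.

Lemma cplx_ind (P : cplx A -> Prop) : P 0 ->
    (forall k c d, P c -> P d -> P (k *: c + d)) ->
    (forall S (x : C S), P (inj x)) ->
  forall c, P c.
Proof.
move=> P0 Plin Pinj c; rewrite (cplx_sum_inj c).
elim/big_ind: _ => // d e Pd Pe; rewrite -[d]scale1r; exact: Plin.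
Qed.

Lemma eq_cplx_lin (f g : {linear cplx A -> cplx A}) :
  (forall S (x : C S), f (inj x) = g (inj x)) -> f =1 g.
Proof.
move=> fg c; rewrite (cplx_sum_inj c) !linear_sum; apply: eq_bigr => S _.
exact: fg.
Qed.

Lemma mcompPl S T k (x x' : C S) (y : C T) :
  mcomp (k *: x + x') y = k *: mcomp x y + mcomp x' y.
Proof. by rewrite /mcomp /ext_oproj linearP /= mulrDl -scalerAl. Qed.

Lemma mcompPr S T k (x : C S) (y y' : C T) :
  mcomp x (k *: y + y') = k *: mcomp x y + mcomp x y'.
Proof. by rewrite /mcomp /ext_oproj linearP /= mulrDr -scalerAr. Qed.

Lemma cplx_mulPl k c c' d : mul (k *: c + c') d = k *: mul c d + mul c' d.
Proof.
rewrite /cplx_mul scaler_sumr -big_split; apply: eq_bigr => S _.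
rewrite scaler_sumr -big_split; apply: eq_bigr => T _.
by rewrite dirsum_addE dirsum_scaleE mcompPl linearP.
Qed.

Lemma cplx_mulPr k c d d' : mul c (k *: d + d') = k *: mul c d + mul c d'.
Proof.
rewrite /cplx_mul scaler_sumr -big_split; apply: eq_bigr => S _.
rewrite scaler_sumr -big_split; apply: eq_bigr => T _.
by rewrite dirsum_addE dirsum_scaleE mcompPr linearP.
Qed.

HB.instance Definition _ c :=
  GRing.isLinear.Build K (cplx A) (cplx A) _ (mul c)
    (fun k => cplx_mulPr k c).

(** A named constant, on which to hang the linearity in the left factor. *)
Definition cplx_mulr d c := mul c d.

HB.instance Definition _ d :=
  GRing.isLinear.Build K (cplx A) (cplx A) _ (cplx_mulr d)
    (fun k c c' => cplx_mulPl k c c' d).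

Lemma cplx_mul0l d : mul 0 d = 0. Proof. exact: (linear0 (cplx_mulr d)). Qed.

Lemma cplx_mul0r c : mul c 0 = 0. Proof. exact: linear0. Qed.

Lemma cplx_mulDl c c' d : mul (c + c') d = mul c d + mul c' d.
Proof. exact: (linearD (cplx_mulr d)). Qed.

Lemma cplx_mul_suml (J : finType) (P : pred J) (F : J -> cplx A) d :
  mul (\sum_(j | P j) F j) d = \sum_(j | P j) mul (F j) d.
Proof. exact: (linear_sum (cplx_mulr d)). Qed.

Lemma cplx_mul_sumr (J : finType) (P : pred J) (F : J -> cplx A) c :
  mul c (\sum_(j | P j) F j) = \sum_(j | P j) mul c (F j).
Proof. exact: linear_sum. Qed.

Lemma cplx_mul_inj S T (x : C S) (y : C T) :
  mul (inj x) (inj y) = if [disjoint S & T] then inj (mcomp x y) else 0.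
Proof.
have mcomp0l S' T' (y' : C T') : mcomp (0 : C S') y' = 0.
  by rewrite /mcomp /ext_oproj linear0 mul0r.
have mcomp0r S' T' (x' : C S') : mcomp x' (0 : C T') = 0.
  by rewrite /mcomp /ext_oproj linear0 mulr0.
rewrite /cplx_mul (bigD1 S) //= [X in _ + X]big1 ?addr0 => [|S' nS]; last first.
  apply: big1 => T' _; rewrite cplx_inj_out 1?eq_sym //.
  by rewrite mcomp0l linear0.
rewrite cplx_inj_in big_mkcond (bigD1 T) //= cplx_inj_in.
rewrite [X in _ + X]big1 ?addr0 // => T' nT.
by rewrite cplx_inj_out 1?eq_sym // mcomp0r linear0 if_same.
Qed.

Lemma diff_inj S (x : C S) : D (inj x) = \sum_(s in S) inj (dcomp s x).
Proof.
rewrite /diff_fun (bigD1 S) //= cplx_inj_in [X in _ + X]big1 ?addr0 // => S' nS.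
by apply: big1 => s _; rewrite cplx_inj_out 1?eq_sym // !linear0.
Qed.

Lemma cplx_gr_lin p q k c d :
  cplx_gr p q c -> cplx_gr p q d -> cplx_gr p q (k *: c + d).
Proof.
move=> hc hd S; have := hc S; have := hd S.
rewrite dirsum_addE dirsum_scaleE; case: ifP => _ => [cS dS|-> ->].
  exact: ext_homog_lin.
by rewrite scaler0 addr0.
Qed.

Lemma cplx_gr0 p q : cplx_gr p q (0 : cplx A).
Proof.
by move=> S; rewrite dirsum_0E; case: ifP => // _; apply: ext_homog0.
Qed.

Lemma cplx_grD p q c d :
  cplx_gr p q c -> cplx_gr p q d -> cplx_gr p q (c + d).
Proof. by move=> hc hd; rewrite -[c]scale1r; apply: cplx_gr_lin. Qed.

Lemma cplx_gr_sum p q (J : finType) (P : pred J) (F : J -> cplx A) :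
  (forall j, P j -> cplx_gr p q (F j)) -> cplx_gr p q (\sum_(j | P j) F j).
Proof.
move=> hF; elim/big_ind: _ => //; first exact: cplx_gr0.
by move=> c d hc hd; rewrite -[c]scale1r; apply: cplx_gr_lin.
Qed.

Lemma cplx_gr_inj S p q (x : C S) :
  (#|S| + q)%N = p -> ext_homog q x -> cplx_gr p q (inj x).
Proof.
move=> <- hx T; have [<-|nST] := eqVneq S T.
  by rewrite eqxx cplx_inj_in.
by rewrite cplx_inj_out //; case: ifP => // _; apply: ext_homog0.
Qed.

Lemma cplx_gr_ind p q (P : cplx A -> Prop) : P 0 ->
    (forall c d, P c -> P d -> P (c + d)) ->
    (forall S (x : C S), (#|S| + q)%N = p -> ext_homog q x -> P (inj x)) ->
  forall c, cplx_gr p q c -> P c.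
Proof.
move=> P0 PD Pinj c hc; rewrite (cplx_sum_inj c).
elim/big_ind: _ => // S _; have := hc S; case: eqP => [Spq cS|_ ->].
  exact: Pinj.
by rewrite linear0.
Qed.

(** Take a bound N above all first degrees #|S| + q; these are at most n plus
    the dimension of V. *)
Lemma cplx_gr_span c : exists N (d : nat -> nat -> cplx A),
  (forall p q, cplx_gr p q (d p q)) /\ c = \sum_(p < N) \sum_(q < N) d p q.
Proof.
pose M := (\dim {:V}).+1; exists (n + M)%N.
exists (fun p q => [ffun S : {set 'I_n} =>
  if (#|S| + q == p)%N then ext_part q (c S : C S) : extflat A S else 0]).
split=> [p q S|].
  by rewrite ffunE; case: eqP => // _; apply: ext_part_homog.
apply/ffunP => S; rewrite exchange_big cplx_sumE /=.
have leSV : (\dim {:subvs_of (flat A S)} <= \dim {:V})%N.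
  by rewrite [leqLHS]dimvf; apply: dimvS (subvf _).
transitivity (\sum_(q < n + M) (ext_part q (c S : C S) : extflat A S)).
  by rewrite ext_sum_part // (leq_ltn_trans leSV) // ltn_addl.
apply: eq_bigr => q _; rewrite cplx_sumE.
under eq_bigr do rewrite ffunE.
have [cq0|/(ext_homog_le (@ext_part_homog _ _ q _)) leq] :=
  eqVneq (ext_part q (c S : C S)) 0.
  by rewrite big1 ?cq0 // => p _; case: ifP.
(* A nonzero part of degree q forces the index p = #|S| + q in range. *)
have ltN : (#|S| + q < n + M)%N.
  rewrite -addnS leq_add // ?ltnS ?(leq_trans leq) //.
  by rewrite -[leqRHS]card_ord max_card.
rewrite (bigD1 (Ordinal ltN)) //= eqxx big1 ?addr0 // => p.
by rewrite -val_eqE /= eq_sym => /negPf->.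
Qed.

(** In the summand S, the first degree is determined by the second, so that
    only the independence of the degrees in one exterior algebra is at stake. *)
Lemma cplx_gr_direct N (c : nat -> nat -> cplx A) :
    (forall p q, cplx_gr p q (c p q)) -> \sum_(p < N) \sum_(q < N) c p q = 0 ->
  forall p q, (p < N)%N -> (q < N)%N -> c p q = 0.
Proof.
move=> hc sc p q ltp ltq; apply/ffunP => S; rewrite dirsum_0E.
have := hc p q S; case: eqP => // Spq _.
pose F r : C S := if (#|S| + r < N)%N then c (#|S| + r)%N r S else 0.
have hF r : ext_homog r (F r).
  rewrite /F; case: ifP => _; last exact: ext_homog0.
  by have := hc (#|S| + r)%N r S; rewrite eqxx.
suff /(ext_homog_uniq hF ltq) : \sum_(r < N) F r = 0.
  by rewrite /F Spq ltp.
have := congr1 (fun c => c S : C S) sc.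
rewrite dirsum_0E exchange_big cplx_sumE => sS; rewrite -[RHS]sS.
apply: eq_bigr => r _.
rewrite cplx_sumE /F; case: ltnP => [ltN|geN].
  rewrite (bigD1 (Ordinal ltN)) //= big1 ?addr0 // => i.
  rewrite -val_eqE eq_sym /= => nSr; have := hc i r S.
  by rewrite (negPf nSr).
rewrite big1 // => i _; have := hc i r S; case: eqP => // Sri.
by have := ltn_ord i; rewrite -Sri ltnNge geN.
Qed.

Section Nondegenerate.
Hypothesis nd : forall S : {set 'I_n}, nondegenerate_on (va_form A) (flat A S).

(** The equality S = T is eliminated here once and for all, so that no later
    proof transports a form along an equality of index sets. *)
Lemma cplx_inj_eq S T (x : C S) (y : C T) :
  S = T -> emb x = emb y -> inj x = inj y.
Proof. by move=> eST; case: T / eST y => y /(emb_inj nd)->. Qed.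

Lemma cplx_mulA : associative mul.
Proof.
move=> c d e.
apply: (@eq_cplx_lin (cplx_mulr (mul d e)) (cplx_mulr e \o cplx_mulr d)) c.
move=> S x; rewrite /= /cplx_mulr.
apply: (@eq_cplx_lin (mul (inj x) \o cplx_mulr e) (cplx_mulr e \o mul (inj x))).
move=> T y; rewrite /= /cplx_mulr.
apply: (@eq_cplx_lin (mul (inj x) \o mul (inj y)) (mul (mul (inj x) (inj y)))).
move=> U z /=.
rewrite !cplx_mul_inj (fun_if (mul (inj x))) (fun_if (mul^~ (inj z))).
rewrite cplx_mul0l cplx_mul0r !cplx_mul_inj disjointUl.
rewrite (disjoint_sym S (T :|: U)) disjointUl.
rewrite (disjoint_sym T S) (disjoint_sym U S).
case: [disjoint S & T]; case: [disjoint T & U]; case: [disjoint S & U] => //=.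
by apply: cplx_inj_eq; rewrite ?setUA // emb_mcompA.
Qed.

Lemma cplx_mul1l : left_id (cplx_one A) mul.
Proof.
elim/cplx_ind=> [|k c d IHc IHd|S x]; first exact: cplx_mul0r.
  by rewrite cplx_mulPr IHc IHd.
rewrite cplx_mul_inj -setI_eq0 set0I eqxx.
by apply: cplx_inj_eq; rewrite ?set0U // emb_mcomp1l.
Qed.

Lemma cplx_mul1r : right_id (cplx_one A) mul.
Proof.
elim/cplx_ind=> [|k c d IHc IHd|S x]; first exact: cplx_mul0l.
  by rewrite cplx_mulPl IHc IHd.
rewrite cplx_mul_inj -setI_eq0 setI0 eqxx.
by apply: cplx_inj_eq; rewrite ?setU0 // emb_mcomp1r.
Qed.

Lemma cplx_grM p q p' q' c d : cplx_gr p q c -> cplx_gr p' q' d ->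
  cplx_gr (p + p') (q + q') (mul c d).
Proof.
move=> hc hd; elim/cplx_gr_ind: c / hc => [|c c' hc hc'|S x Spq hx].
- by rewrite cplx_mul0l; apply: cplx_gr0.
- by rewrite cplx_mulDl; apply: cplx_grD.
elim/cplx_gr_ind: d / hd => [|d d' hd hd'|T y Tpq hy].
- by rewrite cplx_mul0r; apply: cplx_gr0.
- by rewrite linearD /=; apply: cplx_grD.
rewrite cplx_mul_inj; case: ifP => [dST|_]; last exact: cplx_gr0.
apply: cplx_gr_inj; last by apply: ext_homogM; apply: ext_map_homog.
by rewrite cardsU disjoint_setI0 // cards0 subn0 addnACA Spq Tpq.
Qed.

Lemma diff_gr p q c : cplx_gr p q c -> cplx_gr p q.+1 (D c).
Proof.
move=> hc; elim/cplx_gr_ind: c / hc => [|c c' hc hc'|S x Spq hx].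
- by rewrite linear0; apply: cplx_gr0.
- by rewrite linearD /=; apply: cplx_grD.
rewrite diff_inj; apply: cplx_gr_sum => s sS; apply: cplx_gr_inj.
  by rewrite -Spq (cardsD1 s S) sS add1n addnS.
rewrite -add1n; apply: ext_homogM; first exact: ext_homog_inj.
exact: ext_map_homog.
Qed.

(** The terms indexed by (s, t) and (t, s) are opposite; the sum is split along
    s < t and t < s to cancel them. *)
Lemma diff_square c : D (D c) = 0.
Proof.
apply: (@eq_cplx_lin (D \o D) \0) c => S x /=; rewrite diff_inj linear_sum /=.
pose F s t := if (s \in S) && (t \in S :\ s) then
  inj (dcomp t (dcomp s x)) : cplx A else 0.
have F0 s : F s s = 0 by rewrite /F !inE eqxx andbF.
have FC s t : F s t = - F t s.
  rewrite /F !inE (eq_sym t s).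
  case: eqVneq => [_|nst]; rewrite /= ?andbF ?oppr0 //.
  rewrite andbC; case: ifP => [/andP[tS sS]|]; rewrite ?oppr0 // -linearN.
  apply: cplx_inj_eq; first by rewrite !setDDl setUC.
  by rewrite linearN /= emb_dcompC.
transitivity (\sum_(s < n) \sum_(t < n)
    ((if (t < s)%N then F s t else 0) + (if (s < t)%N then F s t else 0))).
  rewrite big_mkcond; apply: eq_bigr => s _.
  transitivity (\sum_t F s t).
    rewrite /F; case: ifP => _ /=; last by rewrite big1.
    by rewrite diff_inj big_mkcond.
  apply: eq_bigr => t _.
  by case: ltngtP => [||/val_inj->]; rewrite ?addr0 ?add0r.
under eq_bigr do rewrite big_split.
rewrite big_split /= [X in _ + X]exchange_big -big_split big1 //= => s _.
rewrite -big_split big1 //= => t _.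
by case: ifP; rewrite ?addr0 // FC addNr.
Qed.

(** It suffices to treat one summand in each factor. If S and T are disjoint the
    terms for s in S and s in T match separately; if they meet, every term
    vanishes. *)
Lemma diff_leibniz p q c d : cplx_gr p q c ->
  D (mul c d) = mul (D c) d + (-1) ^+ q *: mul c (D d).
Proof.
move=> hc; elim/cplx_gr_ind: c / hc => [|c c' IH IH'|S x _ hx].
- by rewrite linear0 !cplx_mul0l linear0 scaler0 addr0.
- rewrite (cplx_mulDl c c' d) (cplx_mulDl c c' (D d)).
  rewrite (linearD D (mul c d) (mul c' d)).
  rewrite (linearD D c c'); apply: etrans (congr2 +%R IH IH') _.
  by rewrite (cplx_mulDl (D c) (D c') d) scalerDr addrACA.
apply: (@eq_cplx_lin (D \o mul (inj x))
  (mul (D (inj x)) \+ ((-1) ^+ q \*: (mul (inj x) \o D)))) => T y /=.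
rewrite cplx_mul_inj !diff_inj cplx_mul_suml cplx_mul_sumr scaler_sumr.
have [dST|ndST] := boolP [disjoint S & T]; last first.
  (* If removing s makes S and T disjoint then s is in both. *)
  rewrite linear0 !big1 ?addr0 // => s sX; rewrite cplx_mul_inj.
    case: ifP => [dST|_]; last by rewrite scaler0.
    rewrite mcomp_dcompr0 ?linear0 ?scaler0 //.
    apply: contraR ndST => nsS; rewrite -(setD1K sX) disjoint_sym disjointUl.
    by rewrite disjoints1 nsS disjoint_sym.
  case: ifP => [dST|_] //; rewrite mcomp_dcomp0 ?linear0 //.
  apply: contraR ndST => nsT; rewrite -(setD1K sX) disjointUl.
  by rewrite disjoints1 nsT.
rewrite diff_inj (eq_bigl (fun s => s \in [predU S & T])) => [|s]; last first.
  by rewrite !inE.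
rewrite bigU //=; congr (_ + _); apply: eq_bigr => s sX.
  have nsT : s \notin T by rewrite (disjointFr dST).
  have dST' : [disjoint S :\ s & T] by apply: disjointWl dST; apply: subD1set.
  rewrite cplx_mul_inj dST'; apply: cplx_inj_eq; first by rewrite setD1_setUl.
  exact: emb_dcomp_mcompl.
have nsS : s \notin S by rewrite (disjointFl dST).
have dST' : [disjoint S & T :\ s] by apply: disjointWr dST; apply: subD1set.
rewrite cplx_mul_inj dST' -linearZ; apply: cplx_inj_eq.
  by rewrite [RHS]setUC setD1_setUl // setUC.
rewrite linearZ; exact: emb_dcomp_mcompr.
Qed.

Theorem cplx_dga :
  is_dga (@cplx_gr K n A) (cplx_one A) mul (diff A).
Proof.
split=> [|k c d|p q c|c|p q c d].
- split.
  + by move=> p q; split=> [|k c d]; [apply: cplx_gr0|apply: cplx_gr_lin].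
  + exact: cplx_gr_span.
  + exact: cplx_gr_direct.
  + by move=> d k c c'; apply: cplx_mulPl.
  + by move=> c k d d'; apply: cplx_mulPr.
  + exact: cplx_mulA.
  + exact: cplx_mul1l.
  + exact: cplx_mul1r.
  + by apply: cplx_gr_inj; [rewrite cards0|apply: ext_homog1].
  + exact: cplx_grM.
- by rewrite linearP.
- by rewrite lfunE; apply: diff_gr.
- by rewrite !lfunE; apply: diff_square.
- by rewrite !lfunE; apply: diff_leibniz.
Qed.

End Nondegenerate.

End Complex.

(** * The homology of a differential graded algebra *)

(** Only finitely many choices are made. Reading the arguments through inord
    needs a positive bound, hence N.+1. *)
Lemma nat_choice2 (T : Type) (N : nat) (P : nat -> nat -> T -> Prop) :
    (forall p q, exists x, P p q x) ->
  exists f, forall p q, (p < N)%N -> (q < N)%N -> P p q (f p q).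
Proof.
move=> exP.
have [f Pf] := fin_all_exists (fun u : 'I_N.+1 * 'I_N.+1 => exP u.1 u.2).
exists (fun p q => f (inord p, inord q)) => p q ltp ltq.
by have := Pf (inord p, inord q); rewrite /= !inordK // ltnW.
Qed.

Section DGAHomology.
Local Open Scope ring_scope.
Variables (K : fieldType) (A : vectType K) (D : 'End(A)).
Variables (gr : nat -> nat -> A -> Prop) (one : A) (mul : A -> A -> A).
Hypothesis dga : is_dga gr one mul D.
Implicit Types (x y a b : A) (c d : nat -> nat -> A).

Let alg := dga_algebra dga.

Let mulPl k x x' y : mul (k *: x + x') y = k *: mul x y + mul x' y.
Proof. exact: mul_linearl alg y k x x'. Qed.

Let mulPr k x y y' : mul x (k *: y + y') = k *: mul x y + mul x y'.
Proof. exact: mul_linearr alg x k y y'. Qed.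

Let mulDl x x' y : mul (x + x') y = mul x y + mul x' y.
Proof. by rewrite -[x]scale1r mulPl !scale1r. Qed.

Let mulDr x y y' : mul x (y + y') = mul x y + mul x y'.
Proof. by rewrite -[y]scale1r mulPr !scale1r. Qed.

Let mul0l y : mul 0 y = 0.
Proof. by apply: (addIr (mul 0 y)); rewrite -mulDl !add0r. Qed.

Let mul0r x : mul x 0 = 0.
Proof. by apply: (addIr (mul x 0)); rewrite -mulDr !add0r. Qed.

Let mul_suml (J : finType) (F : J -> A) y :
  mul (\sum_j F j) y = \sum_j mul (F j) y.
Proof. by apply: (big_morph (mul^~ y)) => // x x'; apply: mulDl. Qed.

Let gr0 p q : gr p q 0. Proof. by have [] := gr_submod alg p q. Qed.

Let grP p q k x y : gr p q x -> gr p q y -> gr p q (k *: x + y).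
Proof. by have [_] := gr_submod alg p q; apply. Qed.

Local Notation total N c := (\sum_(p < N) \sum_(q < N) c p q).
Local Notation homog c := (forall p q, gr p q (c p q)).

(** Truncating outside a square allows decompositions of different sizes to be
    compared in a common larger square. *)
Definition truncate N c p q : A := if (p < N)%N && (q < N)%N then c p q else 0.

Lemma truncate_gr N c :
  (forall p q, (p < N)%N -> (q < N)%N -> gr p q (c p q)) ->
  homog (truncate N c).
Proof.
by move=> hc p q; rewrite /truncate; case: andP => // -[/hc]; apply.
Qed.

Lemma truncate_sum N L c : (N <= L)%N -> total L (truncate N c) = total N c.
Proof.
move=> leNL; rewrite [RHS](big_ord_widen _ (fun p => \sum_(q < N) c p q) leNL).
rewrite [RHS]big_mkcond; apply: eq_bigr => p _; rewrite /truncate.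
case: ifP => _; last by rewrite big1.
by rewrite [RHS](big_ord_widen _ (fun q => c p q) leNL) [RHS]big_mkcond.
Qed.

Lemma homog_uniq N M c d : homog c -> homog d -> total N c = total M d ->
  forall p q, (p < N)%N -> (q < N)%N -> c p q = truncate M d p q.
Proof.
move=> hc hd eqcd p q ltp ltq; pose L := maxn N M.
pose e p q := (-1) *: truncate M d p q + truncate N c p q.
have he : homog e by move=> i j; apply: grP; apply: truncate_gr => *.
have se : total L e = 0.
  under eq_bigr do rewrite big_split -scaler_sumr.
  rewrite big_split -scaler_sumr /= !truncate_sum ?leq_maxl ?leq_maxr //.
  by rewrite eqcd scaleN1r addNr.
have := gr_direct alg he se (leq_trans ltp (leq_maxl _ _))
  (leq_trans ltq (leq_maxl _ _)).
rewrite /e {2}/truncate ltp ltq scaleN1r => /eqP.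
by rewrite addrC subr_eq0 => /eqP.
Qed.

(** The decomposition of the differential of a sum: second degrees move up by
    one, and degree 0 becomes empty. *)
Definition dfamily N c p q : A :=
  if (p < N)%N then (if q is q'.+1 then D (c p q') else 0) else 0.

Lemma dfamily_gr N c : homog c -> homog (dfamily N c).
Proof.
move=> hc p [|q]; rewrite /dfamily; case: ifP => // _.
exact: (dga_degree dga).
Qed.

Lemma dfamily_sum N c : total N.+1 (dfamily N c) = D (total N c).
Proof.
rewrite big_ord_recr /= [X in _ + X]big1 ?addr0 => [|q _]; last first.
  by rewrite /dfamily ltnn.
rewrite linear_sum; apply: eq_bigr => p _.
rewrite big_ord_recl /dfamily /= ltn_ord add0r linear_sum.
by apply: eq_bigr.
Qed.

(** The D (c p q) are the homogeneous parts of D applied to the sum. *)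
Lemma homog_cycle N c : homog c -> D (total N c) = 0 ->
  forall p q, (p < N)%N -> (q < N)%N -> D (c p q) = 0.
Proof.
move=> hc; rewrite -dfamily_sum => /(gr_direct alg (dfamily_gr N hc)) d0.
move=> p q ltp ltq.
by have := d0 p q.+1 (ltnW ltp) ltq; rewrite /dfamily ltp.
Qed.

(** The signs of the Leibniz rule only affect the term in D y, which is 0, so
    that the rule sums up over the homogeneous parts of x. *)
Lemma diff_mul_cycle x y : D y = 0 -> D (mul x y) = mul (D x) y.
Proof.
move=> Dy0; have [N [c [hc ->]]] := gr_span alg x.
rewrite mul_suml !linear_sum mul_suml; apply: eq_bigr => p _.
rewrite mul_suml !linear_sum mul_suml; apply: eq_bigr => q _.
by rewrite /= (dga_leibniz dga _ (hc p q)) Dy0 mul0r scaler0 addr0.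
Qed.

(** The sign in x * D a = (-1)^q D (x * a) is absorbed separately in each
    homogeneous part of x, a cycle by homog_cycle. *)
Lemma cycle_mul_boundary x a : D x = 0 -> exists b, mul x (D a) = D b.
Proof.
have [N [c [hc ->]]] := gr_span alg x => /(homog_cycle hc) Dc0.
exists (\sum_(p < N) \sum_(q < N) (-1) ^+ q *: mul (c p q) a).
rewrite mul_suml linear_sum; apply: eq_bigr => p _.
rewrite mul_suml linear_sum; apply: eq_bigr => q _.
rewrite linearZ /= (dga_leibniz dga _ (hc p q)) Dc0 // mul0l add0r scalerA.
by rewrite -expr2 sqrr_sign scale1r.
Qed.

(** Extending classes linearly to all of A, by a projection onto the cycles,
    avoids carrying proofs of cyclicity in terms; only the values at cycles
    matter. *)
Definition hcls x : homology D := hclass (vsproj (lker D) x).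

Fact hcls_is_linear : linear hcls.
Proof. by move=> k x y; rewrite /hcls /hclass !linearP. Qed.

HB.instance Definition _ :=
  GRing.isLinear.Build K A (homology D) _ hcls hcls_is_linear.

Definition hrep (h : homology D) : A := vsval (repr h : cycles D).

Lemma cycleP (z : cycles D) : D (vsval z) = 0.
Proof. by apply/eqP; rewrite -memv_ker subvsP. Qed.

Lemma hclassE (z : cycles D) : hclass z = hcls (vsval z).
Proof. by rewrite /hcls vsvalK. Qed.

Lemma hrepK h : hcls (hrep h) = h.
Proof. by rewrite -hclassE /hclass; exact: reprK. Qed.

Lemma hcls_eq0P x : D x = 0 -> (hcls x = 0 <-> exists a, x = D a).
Proof.
move=> /eqP; rewrite -memv_ker => xD.
have hE : (hcls x == 0) = (x \in limg D).
  rewrite /hcls /hclass -(linear0 (quotv_pi (boundaries D))).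
  by rewrite quotv_pi_eq subr0 -memv_preim lfunE /= vsprojK.
split=> [/eqP|[a xa]]; first by rewrite hE => /memv_imgP[a _ ->]; exists a.
by apply/eqP; rewrite hE xa memv_img ?memvf.
Qed.

Lemma hcls_eqP x y : D x = 0 -> D y = 0 ->
  (hcls x = hcls y <-> exists a, x = y + D a).
Proof.
move=> Dx0 Dy0; split=> [exy|[a ->]].
  have Dxy : D (x - y) = 0 by rewrite linearB /= Dx0 Dy0 subrr.
  have hxy : hcls (x - y) = 0 by rewrite linearB /= exy subrr.
  have [a xya] := (hcls_eq0P Dxy).1 hxy.
  by exists a; rewrite -xya addrC subrK.
have DDa := dga_square dga a.
rewrite linearD /= (_ : hcls (D a) = 0) ?addr0 //.
by apply/(hcls_eq0P DDa); exists a.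
Qed.

Definition hmul (h h' : homology D) : homology D :=
  hcls (mul (hrep h) (hrep h')).

Lemma cycle_mul x y : D x = 0 -> D y = 0 -> D (mul x y) = 0.
Proof. by move=> Dx0 Dy0; rewrite diff_mul_cycle // Dx0 mul0l. Qed.

(** Independence of the representatives: boundaries times cycles, and cycles
    times boundaries, are boundaries. *)
Lemma hmul_hcls x y : D x = 0 -> D y = 0 ->
  hmul (hcls x) (hcls y) = hcls (mul x y).
Proof.
move=> Dx0 Dy0; have Dr h : D (hrep h) = 0 by apply: cycleP.
have [a xa] := (hcls_eqP (Dr _) Dx0).1 (hrepK (hcls x)).
have [b yb] := (hcls_eqP (Dr _) Dy0).1 (hrepK (hcls y)).
apply/hcls_eqP; try exact: cycle_mul.
have [a' xa'] := cycle_mul_boundary b Dx0.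
exists (a' + mul a (hrep (hcls y))).
rewrite {1}xa mulDl -(diff_mul_cycle a (Dr _)) {1}yb mulDr xa' linearD.
by rewrite addrA.
Qed.

Lemma hcls_ind (P : homology D -> Prop) :
  (forall x, D x = 0 -> P (hcls x)) -> forall h, P h.
Proof. by move=> Pcls h; rewrite -(hrepK h); apply/Pcls/cycleP. Qed.

Lemma diff_one : D one = 0.
Proof.
have := dga_leibniz dga one (gr_one alg).
rewrite expr0 scale1r !(mul_one_l alg, mul_one_r alg) => /eqP.
by rewrite -subr_eq0 opprD addNKr oppr_eq0 => /eqP.
Qed.

Lemma homology_grP p q h :
  homology_gr gr p q h <-> exists x, [/\ gr p q x, D x = 0 & h = hcls x].
Proof.
split=> [[z grz ->]|[x [grx Dx0 ->]]].
  by exists (vsval z); split; rewrite ?cycleP ?hclassE.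
have xD : x \in lker D by rewrite memv_ker Dx0.
by exists (vsproj (lker D) x); rewrite ?vsprojK.
Qed.

(** If homogeneous cycles add up to a boundary D a, then by uniqueness each is
    the differential of a homogeneous part of a. *)
Lemma homology_gr_direct N (c : nat -> nat -> homology D) :
    (forall p q, homology_gr gr p q (c p q)) ->
    \sum_(p < N) \sum_(q < N) c p q = 0 ->
  forall p q, (p < N)%N -> (q < N)%N -> c p q = 0.
Proof.
move=> hc sc p q ltp ltq.
have [x Px] := nat_choice2 N (fun p q => (homology_grP _ _ _).1 (hc p q)).
pose z := truncate N x.
have zE i j : (i < N)%N -> (j < N)%N -> z i j = x i j.
  by move=> lti ltj; rewrite /z /truncate lti ltj.
have hz : homog z.
  by apply: truncate_gr => i j lti ltj; have [] := Px i j lti ltj.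
have Dz i j : (i < N)%N -> (j < N)%N -> D (z i j) = 0.
  by move=> lti ltj; rewrite zE //; have [] := Px i j lti ltj.
have cE i j : (i < N)%N -> (j < N)%N -> c i j = hcls (z i j).
  by move=> lti ltj; rewrite zE //; have [] := Px i j lti ltj.
have Dsz : D (total N z) = 0.
  rewrite linear_sum big1 // => i _; rewrite linear_sum big1 // => j _.
  exact: Dz.
have /(hcls_eq0P Dsz)[a za] : hcls (total N z) = 0.
  rewrite -sc linear_sum; apply: eq_bigr => i _; rewrite linear_sum.
  by apply: eq_bigr => j _; rewrite /= -cE.
have [M [d [hd ad]]] := gr_span alg a.
rewrite cE //; apply/(hcls_eq0P (Dz _ _ ltp ltq)).
have sz : total N z = total M.+1 (dfamily M d) by rewrite za ad dfamily_sum.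
rewrite (homog_uniq hz (dfamily_gr M hd) sz ltp ltq) /truncate /dfamily.
case: ifP => _; last by exists 0; rewrite linear0.
case: ifP => _; last by exists 0; rewrite linear0.
by case: (q) => [|q']; [exists 0; rewrite linear0|exists (d p q')].
Qed.

Lemma homology_gr_span h : exists N (c : nat -> nat -> homology D),
  (forall p q, homology_gr gr p q (c p q)) /\
  h = \sum_(p < N) \sum_(q < N) c p q.
Proof.
elim/hcls_ind: h => x; have [N [c [hc ->]]] := gr_span alg x => Dx0.
exists N, (fun p q => hcls (truncate N c p q)); split=> [p q|].
  apply/homology_grP; exists (truncate N c p q).
  split; [exact: truncate_gr| |by []]; rewrite /truncate.
  by case: andP => [[ltp ltq]|_]; [apply: (homog_cycle hc Dx0)|rewrite linear0].
rewrite -(truncate_sum c (leqnn N)) linear_sum; apply: eq_bigr => p _.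
by rewrite linear_sum.
Qed.

Theorem homology_bigraded_algebra :
  exists (hone : homology D)
         (hmul : homology D -> homology D -> homology D),
    [/\ induced_one one hone, induced_mul mul hmul &
        is_bigraded_algebra (homology_gr gr) hone hmul].
Proof.
have in_ker x : D x = 0 -> x \in lker D by move=> Dx0; rewrite memv_ker Dx0.
exists (hcls one), hmul; split.
- by exists (vsproj (lker D) one); rewrite ?vsprojK // in_ker ?diff_one.
- move=> z w; exists (vsproj (lker D) (mul (vsval z) (vsval w))).
    by rewrite vsprojK // in_ker // cycle_mul ?cycleP.
  by rewrite (hclassE z) (hclassE w) hmul_hcls ?cycleP.
split.
- move=> p q; split=> [|k h h' /homology_grP[x [hx Dx ->]]].
    by apply/homology_grP; exists 0; rewrite !linear0.
  move=> /homology_grP[y [hy Dy ->]]; apply/homology_grP.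
  by exists (k *: x + y); rewrite !linearP /= Dx Dy scaler0 addr0; split; auto.
- exact: homology_gr_span.
- exact: homology_gr_direct.
- elim/hcls_ind=> y Dy k; elim/hcls_ind=> x Dx; elim/hcls_ind=> x' Dx'.
  rewrite -linearP !hmul_hcls // ?mulPl ?linearP //.
  by rewrite /= Dx Dx' scaler0 addr0.
- elim/hcls_ind=> x Dx k; elim/hcls_ind=> y Dy; elim/hcls_ind=> y' Dy'.
  rewrite -linearP !hmul_hcls // ?mulPr ?linearP //.
  by rewrite /= Dy Dy' scaler0 addr0.
- elim/hcls_ind=> x Dx; elim/hcls_ind=> y Dy; elim/hcls_ind=> z Dz.
  by rewrite !hmul_hcls ?cycle_mul // (mul_assoc alg).
- by elim/hcls_ind=> x Dx; rewrite hmul_hcls ?diff_one // (mul_one_l alg).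
- by elim/hcls_ind=> x Dx; rewrite hmul_hcls ?diff_one // (mul_one_r alg).
- apply/homology_grP; exists one.
  by split; rewrite ?diff_one //; apply: gr_one alg.
move=> p q p' q' h h' /homology_grP[x [hx Dx ->]] /homology_grP[y [hy Dy ->]].
apply/homology_grP; exists (mul x y); rewrite hmul_hcls // cycle_mul //.
by split=> //; apply: gr_mul alg _ _ _ _ _ _ hx hy.
Qed.

End DGAHomology.

Theorem proposition2p6 (K : fieldType) (K_char0 : [pchar K]%R =i pred0) (n : nat)
  (A : vector_arrangement K n)
  (A_nondeg : forall S : {set 'I_n},
     nondegenerate_on (va_form A) (flat A S)) :
  is_dga (@cplx_gr K n A) (cplx_one A) (@cplx_mul K n A) (diff A) /\
  exists (hone : homology (diff A))
         (hmul : homology (diff A) -> homology (diff A) -> homology (diff A)),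
    [/\ induced_one (cplx_one A) hone,
        induced_mul (@cplx_mul K n A) hmul &
        is_bigraded_algebra (homology_gr (@cplx_gr K n A)) hone hmul].
Proof.
split; first exact: cplx_dga.
exact: homology_bigraded_algebra (cplx_dga A_nondeg).
Qed.
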